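(* Let $W$ be the affine Weyl group of type $\widetilde{A}_2$ (setting and notation as in the context). For every $x\in W\setminus\{\mathrm{id}\}$ and every $y\in W$, \[ [x,y]=\{z\in W \;:\; \operatorname{cen}(z)\in \mathcal{C}_y \ \text{ and } \ \operatorname{cen}(z)\notin \mathcal{St}(x)^{\circ}\}, \] where $[x,y]=\{z\in W: x\le z\le y\}$ is the Bruhat interval and $\mathcal{St}(x)^{\circ}$ denotes the interior of $\mathcal{St}(x)$.
   Context: Setting. $E$ is a real Euclidean plane with inner product $(-,-)$. $\Phi\subset E$ is a root system of type $A_2$ with simple roots $\alpha_1,\alpha_2$, $(\alpha_i,\alpha_i)=2$, $(\alpha_1,\alpha_2)=-1$, $\rho=\alpha_1+\alpha_2$, positive roots $\Phi_+=\{\alpha_1,\alpha_2,\rho\}$; fundamental weights $\varpi_1,\varpi_2$ satisfy $(\varpi_i,\alpha_j)=\delta_{ij}$ (so $\rho=\varpi_1+\varpi_2$). For $\alpha\in\Phi$, $k\in\mathbb{Z}$, $H_{\alpha,k}=\{v:(\alpha,v)=k\}$ and $s_{\alpha,k}$ is the orthogonal reflection in $H_{\alpha,k}$. Alcoves are the connected components of $E\setminus\bigcup H_{\alpha,k}$; the fundamental alcove is $A_+=\{v:-1<(\alpha,v)<0 \ \forall \alpha\in\Phi_+\}$ (vertices $0,-\varpi_1,-\varpi_2$). $W$ is the group generated by $s_0=s_{\rho,-1}$, $s_1=s_{\alpha_1,0}$, $s_2=s_{\alpha_2,0}$; $(W,\{s_0,s_1,s_2\})$ is a Coxeter system of type $\widetilde{A}_2$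 with Bruhat order $\le$ and length $\ell$; indices of $s_i$ are read mod $3$. The map $w\mapsto wA_+$ is a bijection from $W$ to the set of alcoves, and $\operatorname{cen}(w)$ denotes the centroid of $wA_+$. $W_f=\langle s_1,s_2\rangle$. $C_+=\{v:(\alpha_1,v)>0,(\alpha_2,v)>0\}$ and $D=\{w\in W: wA_+\subset C_+\}$ (dominant elements); $s_0D=\{s_0w:w\in D\}$. For $k\ge1$, $\mathbf{x}_k=s_1s_2s_3\cdots s_k$ (indices mod 3). Symmetries. $\delta$ is the rotation of $E$ of order $3$ about the centroid of $A_+$ mapping the wall $H_{\rho,-1}$ to $H_{\alpha_1,0}$, $H_{\alpha_1,0}$ to $H_{\alpha_2,0}$, and $H_{\alpha_2,0}$ to $H_{\rho,-1}$; $\sigma$ is the orthogonal reflection of $E$ in the line $\mathbb{R}\rho$. For such an isometry $g$ and $w\in W$ put $g(w)=gwg^{-1}\in W$, so $g(wA_+)=g(w)A_+$; thus $\delta(s_i)=s_{i+1}$ and $\sigma$ fixes $s_0$ and swaps $s_1,s_2$. $G$ is the group of permutations of $W$ generated by $\delta,\sigma$ and $\iota:w\mapsto w^{-1}$. The polygon $\mathcal{C}_y$ (convex hull of the centers of the listed elements): if $y=\mathrm{id}$, $\mathcal{C}_y=\{\operatorname{cen}(\mathrm{id})\}$; if $y=s\in\{s_0,s_1,s_2\}$, $\mathcal{C}_y=\operatorname{Conv}\{\operatorname{cen}(\mathrm{id}),\operatorname{cen}(s)\}$; if $y\in\delta^i(D)$ ($i\in\{0,1,2\}$), $\mathcal{C}_y=\operatorname{Conv}\{\operatorname{cen}(wy):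 w\in\langle s_{i+1},s_{i+2}\rangle\}$; if $y\in\delta^i(s_0D)$, $\mathcal{C}_y=\operatorname{Conv}$ of the centers of $y, s_iy, s_{i+1}s_iy, s_{i+2}s_iy, s_is_{i+1}s_iy, s_is_{i+2}s_iy$; if $y=g(\mathbf{x}_k)$ with $g\in G$, $k\ge2$, $\mathcal{C}_y=\operatorname{Conv}$ of the centers of $g(\mathbf{x}_k),g(s_1\mathbf{x}_k),g(s_2s_1\mathbf{x}_k),g(s_1s_2s_1\mathbf{x}_k)$. The star $\mathcal{St}(x)$. For $c,p\in E$ let $T^{\triangleleft}(c;p)=\{v: M_1(v-c)\le M_1(p-c)\}$ with $M_1(u)=\max\{(\varpi_1,u),(-\varpi_2,u),(\varpi_2-\varpi_1,u)\}$, and $T^{\triangleright}(c;p)=\{v:M_2(v-c)\le M_2(p-c)\}$ with $M_2(u)=\max\{(\varpi_2,u),(-\varpi_1,u),(\varpi_1-\varpi_2,u)\}$ (closed equilateral triangles centered at $c$ with $p$ on the boundary). If $x\in D$: $\mathcal{St}(x)=T^{\triangleleft}(-\varpi_1;\operatorname{cen}(x))\cup T^{\triangleright}(-\varpi_2;\operatorname{cen}(x))$. If $x\in s_0D\cup\{\delta(\mathbf{x}_k):k\ge1\}$: $\mathcal{St}(x)=T^{\triangleleft}(0;\operatorname{cen}(x))\cup T^{\triangleright}(0;\operatorname{cen}(x))$. For general $x\neq\mathrm{id}$ there is $g\in\langle\delta,\sigma\rangle$ with $g(x)\in D\cup s_0D\cup\{\delta(\mathbf{x}_k):k\ge1\}$,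 and $\mathcal{St}(x)=g^{-1}(\mathcal{St}(g(x)))$ (with $g$ acting as an isometry of $E$).
   Formalization: In the star, the family δ(x_k) is replaced by δ^{-1}(x_k) (as written the claim fails for x = y = s_2); and for y = g(x_k), where the polygon depends on the choice of g in G, C_y is the union of the polygons over all such g and k. *)

(* Defs.v *)
From HB Require Import structures.
From Stdlib Require Import Relations.
From mathcomp Require Import all_boot all_order all_algebra.
From mathcomp Require Import ring lra.
From mathcomp Require Import all_classical all_reals all_analysis.

Set Implicit Arguments.
Unset Strict Implicit.
Unset Printing Implicit Defensive.

Import Order.TTheory GRing.Theory Num.Theory.
Import numFieldNormedType.Exports.

Local Open Scope classical_set_scope.
Local Open Scope ring_scope.

Definition dot (R : realType) (u v : 'rV[R]_2) : R :=
  \sum_(i < 2) u ord0 i * v ord0 i.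

(* The Euclidean plane is R^2 with its dot product; the simple roots are any
   two vectors with the Gram matrix of type A_2. *)
Record rootsA2 (R : realType) := RootsA2 {
  alpha1 : 'rV[R]_2;
  alpha2 : 'rV[R]_2;
  varpi1 : 'rV[R]_2;
  varpi2 : 'rV[R]_2;
  dot_alpha11 : dot alpha1 alpha1 = 2;
  dot_alpha22 : dot alpha2 alpha2 = 2;
  dot_alpha12 : dot alpha1 alpha2 = -1;
  dot_varpi11 : dot varpi1 alpha1 = 1;
  dot_varpi12 : dot varpi1 alpha2 = 0;
  dot_varpi21 : dot varpi2 alpha1 = 0;
  dot_varpi22 : dot varpi2 alpha2 = 1 }.

Section AffineA2.
Variables (R : realType) (P : rootsA2 R).

Local Notation E := 'rV[R]_2.
Local Notation a1 := (alpha1 P).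
Local Notation a2 := (alpha2 P).
Local Notation w1 := (varpi1 P).
Local Notation w2 := (varpi2 P).

Definition rho : E := a1 + a2.

Definition hyperplane (a : E) (k : R) : set E := [set v | dot a v = k].

Definition refl (a : E) (k : R) (v : E) : E :=
  v - (2 * (dot a v - k) / dot a a) *: a.

(* indices are read modulo 3 *)
Definition s (i : nat) : E -> E :=
  match (i %% 3)%N with
  | 0%N => refl rho (-1)
  | 1%N => refl a1 0
  | _ => refl a2 0
  end.

(* [prods [:: i_1; ...; i_n]] is s_{i_1} ... s_{i_n} *)
Definition prods (l : seq nat) : E -> E :=
  foldr (fun i f => s i \o f) id l.

(* The s_i being involutions, the words in the s_i form the group that they
   generate; likewise for [parabolic]. *)
Definition W : set (E -> E) := [set w | exists l, w = prods l].

Definition parabolic (i j : nat) : set (E -> E) :=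
  [set w | exists2 l : seq nat, {subset l <= [:: i; j]} & w = prods l].

(* the inverse of a bijection of E *)
Definition invf (f : E -> E) (v : E) : E := xget 0 [set u | f u = v].

Definition ell (w : E -> E) : nat :=
  xget 0%N [set n | (exists2 l, size l = n & w = prods l) /\
                    (forall l, w = prods l -> (n <= size l)%N)].

Definition reflection : set (E -> E) :=
  [set t | exists2 w, W w & exists i, t = w \o s i \o invf w].

Definition bruhat_step (u v : E -> E) : Prop :=
  [/\ W u, (exists2 t, reflection t & v = u \o t) & (ell u < ell v)%N].

Definition bruhat : (E -> E) -> (E -> E) -> Prop :=
  clos_refl_trans (E -> E) bruhat_step.

Definition bruhat_interval (x y : E -> E) : set (E -> E) :=
  [set z | [/\ W z, bruhat x z & bruhat z y]].

Definition Aplus : set E :=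
  [set v | [/\ -1 < dot a1 v < 0, -1 < dot a2 v < 0 & -1 < dot rho v < 0]].

Definition Cplus : set E := [set v | 0 < dot a1 v /\ 0 < dot a2 v].

(* w A_+ is the triangle with vertices w(0), w(-varpi_1), w(-varpi_2) *)
Definition cen (w : E -> E) : E := 3^-1 *: (w 0 + w (- w1) + w (- w2)).

Definition D : set (E -> E) := [set w | W w /\ w @` Aplus `<=` Cplus].

Definition s0D : set (E -> E) := [set s 0 \o w | w in D].

Definition xk (k : nat) : E -> E := prods (iota 1 k).

(* The affine map 0 |-> -varpi_1 |-> -varpi_2 |-> 0; the lemmas [delta_*] below
   identify it as the rotation of order 3 about the centroid of A_+ that
   permutes the walls as prescribed. *)
Definition delta (v : E) : E := - (dot rho v + 1) *: w1 + dot a1 v *: w2.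

(* orthogonal reflection in the line spanned by rho *)
Definition sigma (v : E) : E := (2 * dot rho v / dot rho rho) *: rho - v.

Definition conjf (g w : E -> E) : E -> E := g \o w \o invf g.

End AffineA2.

(* Closure of S and id under composition: the group generated by S as soon as
   the elements of S have finite order, which is how it is used. *)
Inductive generated (T : Type) (S : set (T -> T)) : set (T -> T) :=
| generated_id : generated S id
| generated_comp f g : S f -> generated S g -> generated S (f \o g).

Definition convex_hull (R : realType) (A : set 'rV[R]_2) : set 'rV[R]_2 :=
  smallest (@convex_set R 'rV[R]_2) A.

Section PolygonStar.
Variables (R : realType) (P : rootsA2 R).

Local Notation E := 'rV[R]_2.
Local Notation w1 := (varpi1 P).
Local Notation w2 := (varpi2 P).
Local Notation s := (s P).
Local Notation prods := (prods P).
Local Notation cen := (cen P).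
Local Notation D := (D P).
Local Notation s0D := (s0D P).
Local Notation xk := (xk P).
Local Notation delta := (delta P).
Local Notation sigma := (sigma P).

Definition isoms : set (E -> E) := generated [set delta; sigma].

Definition G : set ((E -> E) -> (E -> E)) :=
  generated [set conjf delta; conjf sigma; @invf R].

(* The five clauses concern disjoint sets of y.  In the last one, y may be
   g(x_k) for two elements g of G, only one of which lies in <delta, sigma>.
   The polygon attached to the other g is contained in the one attached to that
   g, so that the union over g is that polygon. *)
Inductive polygon (y : E -> E) : set E :=
| polygon_id v of
    y = id & v = cen id : polygon y v
| polygon_s i v of
    y = s i & convex_hull [set cen id; cen (s i)] v : polygon y v
| polygon_D i v of
    (i < 3)%N & [set iter i (conjf delta) w | w in D] y &
    convex_hull [set cen (w \o y) | w in parabolic P i.+1 i.+2] v : polygon y v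
| polygon_s0D i v of
    (i < 3)%N & [set iter i (conjf delta) w | w in s0D] y &
    convex_hull [set cen y;
              cen (prods [:: i] \o y);
              cen (prods [:: i.+1; i] \o y);
              cen (prods [:: i.+2; i] \o y);
              cen (prods [:: i; i.+1; i] \o y);
              cen (prods [:: i; i.+2; i] \o y)] v : polygon y v
| polygon_xk g k v of
    G g & (2 <= k)%N & y = g (xk k) &
    convex_hull [set cen (g (xk k));
              cen (g (prods [:: 1%N] \o xk k));
              cen (g (prods [:: 2%N; 1%N] \o xk k));
              cen (g (prods [:: 1%N; 2%N; 1%N] \o xk k))] v : polygon y v.

Definition M1 (u : E) : R :=
  Num.max (dot w1 u) (Num.max (dot (- w2) u) (dot (w2 - w1) u)).

Definition M2 (u : E) : R :=
  Num.max (dot w2 u) (Num.max (dot (- w1) u) (dot (w1 - w2) u)).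

Definition triangle_l (c p : E) : set E := [set v | M1 (v - c) <= M1 (p - c)].

Definition triangle_r (c p : E) : set E := [set v | M2 (v - c) <= M2 (p - c)].

(* delta^-1(x_k) = s_0 s_1 ... s_{k-1}: these alcoves start at s_0 A_+, beyond
   the wall of A_+ opposite to the centre 0 of the triangles.  (The words
   delta(x_k) = s_2 s_3 ... s_{k+1} start at s_2 A_+, which has 0 as a vertex.) *)
Definition strip : set (E -> E) :=
  [set x | exists2 k, (1 <= k)%N & x = conjf (invf delta) (xk k)].

Inductive star0 (x : E -> E) : set E :=
| star0_D v of
    D x & (triangle_l (- w1) (cen x) `|` triangle_r (- w2) (cen x)) v :
    star0 x v
| star0_s0D v of
    (s0D `|` strip) x & (triangle_l 0 (cen x) `|` triangle_r 0 (cen x)) v :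
    star0 x v.

(* g^-1(star0 (g(x))), for any isometry g that brings x into
   D, s_0 D or [strip]; [star0] is empty elsewhere *)
Definition star (x : E -> E) : set E :=
  [set v | exists2 g, isoms g & (g @^-1` star0 (conjf g x)) v].

End PolygonStar.

Section Sanity.
Variables (R : realType).

Local Notation E := 'rV[R]_2.

Lemma dotE (u v : E) :
  dot u v = u ord0 ord0 * v ord0 ord0 + u ord0 ord_max * v ord0 ord_max.
Proof.
rewrite /dot big_ord_recl big_ord1.
by have -> : lift ord0 ord0 = ord_max :> 'I_2 by apply/val_inj.
Qed.

Lemma dotC (u v : E) : dot u v = dot v u.
Proof. by rewrite !dotE; ring. Qed.

Lemma dotDr (u v w : E) : dot u (v + w) = dot u v + dot u w.
Proof. by rewrite !dotE !mxE; ring. Qed.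

Lemma dotNr (u v : E) : dot u (- v) = - dot u v.
Proof. by rewrite !dotE !mxE; ring. Qed.

Lemma dotZr (u v : E) k : dot u (k *: v) = k * dot u v.
Proof. by rewrite !dotE !mxE; ring. Qed.

Lemma dotDl (u v w : E) : dot (u + v) w = dot u w + dot v w.
Proof. by rewrite !(dotC _ w) dotDr. Qed.

Lemma row2P (u v : E) :
  u ord0 ord0 = v ord0 ord0 -> u ord0 ord_max = v ord0 ord_max -> u = v.
Proof.
move=> h0 h1; apply/rowP => -[[|[|//]] lti].
- by have -> : Ordinal lti = ord0 by apply/val_inj.
- by have -> : Ordinal lti = ord_max by apply/val_inj.
Qed.

Lemma rootsA2_inhabited : inhabited (rootsA2 R).
Proof.
pose mk (p q : R) : E := \row_(i < 2) (if i == ord0 then p else q).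
have dmk p q r t : dot (mk p q) (mk r t) = p * r + q * t.
  by rewrite dotE !mxE.
pose a := Num.sqrt 2 : R; pose b := Num.sqrt 6 : R.
have ha : a * a = 2 by rewrite -expr2 sqr_sqrtr.
have hb : b * b = 6 by rewrite -expr2 sqr_sqrtr.
constructor; apply: (@RootsA2 R (mk a 0) (mk (- a / 2) (b / 2))
  (mk (a / 2) (b / 6)) (mk 0 (b / 3))); rewrite dmk; nra.
Qed.

Variable P : rootsA2 R.

Local Notation a1 := (alpha1 P).
Local Notation a2 := (alpha2 P).
Local Notation w1 := (varpi1 P).
Local Notation w2 := (varpi2 P).

Lemma dot_inj (u v : E) : dot a1 u = dot a1 v -> dot a2 u = dot a2 v -> u = v.
Proof.
have := dot_alpha11 P; have := dot_alpha22 P; have := dot_alpha12 P.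
rewrite !dotE.
set p := a1 _ _; set q := a1 _ _; set r := a2 _ _; set t := a2 _ _.
set u0 := u _ _; set u1 := u _ _; set v0 := v _ _; set v1 := v _ _.
move=> h12 h22 h11 h1 h2.
have det : (p * t - q * r) ^+ 2 = 3.
  have -> : (p * t - q * r) ^+ 2 =
    (p * p + q * q) * (r * r + t * t) - (p * r + q * t) ^+ 2 by ring.
  by rewrite h12 h22 h11; ring.
have dn0 : p * t - q * r != 0.
  by rewrite -sqrf_eq0 det pnatr_eq0.
apply: row2P; rewrite -/u0 -/u1 -/v0 -/v1; apply: (mulfI dn0).
- have -> : (p * t - q * r) * u0 =
    t * (p * u0 + q * u1) - q * (r * u0 + t * u1) by ring.
  by rewrite h1 h2; ring.
- have -> : (p * t - q * r) * u1 =
    p * (r * u0 + t * u1) - r * (p * u0 + q * u1) by ring.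
  by rewrite h1 h2; ring.
Qed.

Let dotw := (dotC a1 w1, dotC a1 w2, dotC a2 w1, dotC a2 w2,
  dot_varpi11 P, dot_varpi12 P, dot_varpi21 P, dot_varpi22 P).

Lemma dot1_delta v : dot a1 (delta P v) = - (dot (rho P) v + 1).
Proof. by rewrite /delta dotDr !dotZr !dotw; ring. Qed.

Lemma dot2_delta v : dot a2 (delta P v) = dot a1 v.
Proof. by rewrite /delta dotDr !dotZr !dotw; ring. Qed.

Lemma dotr_delta v : dot (rho P) (delta P v) = - dot a2 v - 1.
Proof. by rewrite dotDl dot1_delta dot2_delta dotDl; ring. Qed.

Lemma delta_wall0 :
  delta P @^-1` hyperplane a1 0 = hyperplane (rho P) (-1).
Proof.
by apply/seteqP; split=> v; rewrite /hyperplane /= dot1_delta => h; lra.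
Qed.

Lemma delta_wall1 : delta P @^-1` hyperplane a2 0 = hyperplane a1 0.
Proof. by apply/seteqP; split=> v; rewrite /hyperplane /= dot2_delta. Qed.

Lemma delta_wall2 :
  delta P @^-1` hyperplane (rho P) (-1) = hyperplane a2 0.
Proof.
by apply/seteqP; split=> v; rewrite /hyperplane /= dotr_delta => h; lra.
Qed.

Lemma delta_order3 v : delta P (delta P (delta P v)) = v.
Proof.
apply: dot_inj; rewrite ?dot2_delta ?dot1_delta ?dotr_delta ?dot2_delta;
  by rewrite ?dot1_delta ?dotDl; ring.
Qed.

Lemma delta_cen : delta P (cen P id) = cen P id.
Proof.
by apply: dot_inj; rewrite ?dot1_delta ?dot2_delta /cen ?dotDl
  ?(dotZr, dotDr, dotNr) !dotw /=; rewrite !dotE !mxE; field.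
Qed.

Lemma varpi_expand v : v = dot a1 v *: w1 + dot a2 v *: w2.
Proof. by apply: dot_inj; rewrite dotDr !dotZr !dotw; ring. Qed.

Lemma varpi1E : w1 = (2 / 3) *: a1 + (1 / 3) *: a2.
Proof.
apply: dot_inj; rewrite dotDr !dotZr ?(dotC a2 a1) !dotw;
  by rewrite (dot_alpha11, dot_alpha22) dot_alpha12; field.
Qed.

Lemma varpi2E : w2 = (1 / 3) *: a1 + (2 / 3) *: a2.
Proof.
apply: dot_inj; rewrite dotDr !dotZr ?(dotC a2 a1) !dotw;
  by rewrite (dot_alpha11, dot_alpha22) dot_alpha12; field.
Qed.

Lemma delta_isometry u v :
  dot (delta P u - delta P v) (delta P u - delta P v) = dot (u - v) (u - v).
Proof.
have dotnE w : dot w w = (2 / 3) *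
    (dot a1 w ^+ 2 + dot a1 w * dot a2 w + dot a2 w ^+ 2).
  rewrite {2}(varpi_expand w) dotDr !dotZr varpi1E varpi2E !dotDr !dotZr.
  by rewrite !(dotC w); field.
have dotB a (p q : E) : dot a (p - q) = dot a p - dot a q.
  by rewrite dotDr dotNr.
by rewrite !dotnE !dotB !dot1_delta !dot2_delta !dotDl; field.
Qed.

End Sanity.

(* Main.v *)
(* Let alpha_0 = -rho - 1, so that alpha_0, alpha_1, alpha_2 are the affine
   functions vanishing on the walls of s_0, s_1, s_2; their sum is -1.  Attach
   to an alcove A the integers A_i with A_i - 1 < alpha_i < A_i on A.  Then
   length is the l^1 norm, <delta, sigma> permutes the coordinates, j is a left
   descent of A iff A_j >= 1, and alpha_i - alpha_j takes the value A_i - A_j at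
   the centre of A.
   The Bruhat order becomes the relation [hexle]: for i, j, k distinct,
     A_i - A_j <= max (B_i - B_j, B_j - B_k - 1, B_k - B_i - 2).
   Indeed, if j is a descent of B, both relations satisfy
   A <= B <-> min (A, s_j A) <= s_j B (the lifting property), so they agree by
   induction on the length.
   For fixed B the six inequalities cut out a hexagon, which is the polygon of
   B: its corners are the centres listed in the definition of the polygon.  For
   fixed A <> A_+, the negation of each inequality puts the centre of B in an
   open triangle; for centres the six triangles reduce to two, whose closures
   form the star. *)

From Stdlib Require Import Relations.
From mathcomp Require Import all_boot all_order all_algebra.
From mathcomp Require Import ring lra zify.
From mathcomp Require Import fingroup perm.
From mathcomp Require Import all_classical all_reals all_analysis.
Require Import Defs.

Import Order.TTheory GRing.Theory Num.Theory.
Import numFieldNormedType.Exports.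

Set Implicit Arguments.
Unset Strict Implicit.
Unset Printing Implicit Defensive.

Local Open Scope classical_set_scope.
Local Open Scope ring_scope.

(** * Triples of distinct indices modulo 3 *)

Lemma ord3_ind (Q : 'I_3 -> Prop) : Q 0 -> Q 1 -> Q 2 -> forall i, Q i.
Proof.
by move=> Q0 Q1 Q2 i; rewrite -[i]natr_Zp; case: i => [[|[|[|]]]].
Qed.

Definition distinct3 (i j k : 'I_3) : bool := [&& i != j, j != k & k != i].

Lemma distinct3_rot i j k : distinct3 i j k -> distinct3 j k i.
Proof. by case/and3P=> ij jk ki; apply/and3P. Qed.

Lemma distinct3_flip i j k : distinct3 i j k -> distinct3 i k j.
Proof. by case/and3P=> ij jk ki; apply/and3P; split; rewrite eq_sym. Qed.

Lemma distinct3_shift i : distinct3 i (i + 1) (i + 2).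
Proof. by elim/ord3_ind: i. Qed.

Lemma distinct3_natr n : distinct3 n%:R n.+1%:R n.+2%:R.
Proof. by rewrite -!natr1 -addrA; apply: distinct3_shift. Qed.

Lemma distinct3_third i j : i != j -> distinct3 i j (- (i + j)).
Proof. by elim/ord3_ind: i; elim/ord3_ind: j. Qed.

Lemma distinct3E i j k : distinct3 i j k -> k = - (i + j).
Proof.
by elim/ord3_ind: i; elim/ord3_ind: j; elim/ord3_ind: k => // _;
  apply/val_inj.
Qed.

Lemma distinct3_cover i j k l :
  distinct3 i j k -> [\/ l = i, l = j | l = k].
Proof.
elim/ord3_ind: i; elim/ord3_ind: j; elim/ord3_ind: k => // _;
  by elim/ord3_ind: l; first [exact: Or31 | exact: Or32 | exact: Or33].
Qed.

Lemma distinct3_completion i j k l m : distinct3 i j k -> distinct3 i l m ->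
  (l = j /\ m = k) \/ (l = k /\ m = j).
Proof.
by elim/ord3_ind: i; elim/ord3_ind: j; elim/ord3_ind: k => //= _;
  elim/ord3_ind: l; elim/ord3_ind: m => //= _; auto.
Qed.

Lemma distinct3_ind (Q : 'I_3 -> 'I_3 -> 'I_3 -> Prop) i j k :
  distinct3 i j k ->
  Q i j k -> Q j k i -> Q k i j -> Q i k j -> Q k j i -> Q j i k ->
  forall l m n, distinct3 l m n -> Q l m n.
Proof.
by elim/ord3_ind: i; elim/ord3_ind: j; elim/ord3_ind: k => // _ ? ? ? ? ? ?;
  elim/ord3_ind; elim/ord3_ind; elim/ord3_ind.
Qed.

Lemma forall_neq_distinct3 (Q : 'I_3 -> Prop) i j k : distinct3 i j k ->
  (forall l, l != i -> Q l) <-> Q j /\ Q k.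
Proof.
move=> d; split=> [Qni|[Qj Qk] l].
  by case/and3P: d => ij jk ki; split; apply: Qni; rewrite // eq_sym.
by have [->|->|->] := distinct3_cover l d; rewrite ?eqxx.
Qed.

Lemma big_distinct3 (T : Type) (idx : T) (op : Monoid.com_law idx)
    (F : 'I_3 -> T) i j k : distinct3 i j k ->
  \big[op/idx]_l F l = op (F i) (op (F j) (F k)).
Proof.
move=> /[dup] d /and3P[ij jk ki].
rewrite (bigD1 i) //= (bigD1 j) 1?eq_sym //= (bigD1 k) ?ki 1?eq_sym //=.
rewrite big1 ?Monoid.mulm1 // => l.
by have [->|->|->] := distinct3_cover l d; rewrite eqxx ?andbF.
Qed.

Lemma distinct3_permute (t : 'S_3) i j k :
  distinct3 (t i) (t j) (t k) = distinct3 i j k.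
Proof. by rewrite /distinct3 !(inj_eq perm_inj). Qed.

Lemma distinct3_perm i j k : distinct3 i j k ->
  exists t : 'S_3, [/\ t 0 = i, t 1 = j & t 2 = k].
Proof.
move=> d; pose f (l : 'I_3) := if l == 0 then i else if l == 1 then j else k.
have f_inj : injective f.
  by elim/ord3_ind; elim/ord3_ind => //; rewrite /f /= => e; move: d;
    rewrite /distinct3 e eqxx /= ?andbF.
by exists (perm f_inj); split; rewrite permE.
Qed.

Lemma forall_neq_perm (Q : 'I_3 -> Prop) (t : 'S_3) i :
  (forall l, l != i -> Q (t l)) <-> (forall l, l != t i -> Q l).
Proof.
split=> Qt l li; last by apply: Qt; rewrite (inj_eq perm_inj).
rewrite -[l](permKV t); apply: Qt.
by rewrite -(inj_eq (@perm_inj _ t)) permKV.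
Qed.

Definition shift3 (c : 'I_3) : 'S_3 := perm (@addIr _ (- c)).

Lemma shift3D c d : (shift3 c * shift3 d)%g = shift3 (c + d).
Proof. by apply/permP => i; rewrite permM !permE opprD addrA. Qed.

Lemma shift3VE c i : (shift3 c)^-1%g i = i + c.
Proof.
by apply: (@perm_inj _ (shift3 c)); rewrite -permM mulVg perm1 permE addrK.
Qed.

Definition opp3 : 'S_3 := perm (@oppr_inj 'I_3).

Lemma perm3_dihedral (t : 'S_3) :
  exists c, t = shift3 c \/ t = (opp3 * shift3 c)%g.
Proof.
have d : distinct3 (t 0) (t 1) (t 2) by rewrite distinct3_permute.
have t2 := distinct3E d; exists (- t 0).
have /orP[/eqP t1|/eqP t1] : (t 1 == 1 + t 0) || (t 1 == - 1 + t 0).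
  by move: d; elim/ord3_ind: (t 0); elim/ord3_ind: (t 1);
    elim/ord3_ind: (t 2).
- left; apply/permP; elim/ord3_ind; rewrite permE ?t2 ?t1;
    elim/ord3_ind: (t 0); exact/val_inj.
- right; apply/permP; elim/ord3_ind; rewrite permM !permE ?t2 ?t1;
    elim/ord3_ind: (t 0); exact/val_inj.
Qed.

(** * Alcoves as triples of integers *)

(* The triples of sum 0 and 1 are the images of A_+ under the elements of W of
   even and odd length. *)
Record alcove := Alcove {
  coord :> 'I_3 -> int;
  sum_coord01 : \sum_i coord i \in [:: 0; 1] }.

Implicit Types A B C X Z : alcove.

Lemma alcove_eq A B : A =1 B -> A = B.
Proof.
case: A B => [A sA] [B sB] /= /funext eAB; rewrite {A}eAB in sA *.
by congr Alcove; apply: bool_irrelevance.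
Qed.

Lemma alcove_eq3 A B i j k : distinct3 i j k ->
  A i = B i -> A j = B j -> A k = B k -> A = B.
Proof.
move=> d ? ? ?; apply: alcove_eq => l.
by have [->|->|->] := distinct3_cover l d.
Qed.

Definition odd_alcove A : bool := \sum_i A i == 1.

Lemma sum_coord A i j k : distinct3 i j k ->
  A i + (A j + A k) = odd_alcove A :> int.
Proof.
move=> /(big_distinct3 +%R A) /= <-; rewrite /odd_alcove.
by have := sum_coord01 A; rewrite !inE => /orP[] /eqP->.
Qed.

Lemma alcove0_subproof : \sum_(i < 3) (0 : int) \in [:: 0; 1].
Proof. by rewrite big1. Qed.

Definition alcove0 : alcove := Alcove alcove0_subproof.

Lemma alcove0E i : alcove0 i = 0.
Proof. by []. Qed.

Lemma odd_alcove0 : odd_alcove alcove0 = false.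
Proof. by rewrite /odd_alcove big1. Qed.

(* The reflection in the line alpha_i = m; [- (i + l)] is the third index. *)
Definition alcove_refl_coord (i : 'I_3) (m : int) (A : 'I_3 -> int) (l : 'I_3) :
    int :=
  if l == i then 2 * m + 1 - A i else - A (- (i + l)) - m.

Lemma alcove_refl_subproof i m A :
  \sum_l alcove_refl_coord i m A l \in [:: 0; 1].
Proof.
have d := distinct3_shift i; have [/and3P[ij jk ki] sA] := (d, sum_coord A d).
rewrite (big_distinct3 _ _ d) /alcove_refl_coord eqxx [_ + 1 == i]eq_sym.
rewrite (negPf ij) (negPf ki) -(distinct3E d) -(distinct3E (distinct3_flip d)).
by rewrite !inE /=; case: odd_alcove sA; lia.
Qed.

Definition alcove_refl i m A : alcove :=
  Alcove (alcove_refl_subproof i m A).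

Lemma alcove_reflE i j k : distinct3 i j k -> forall m A,
  (alcove_refl i m A i = 2 * m + 1 - A i) *
  (alcove_refl i m A j = - A k - m) * (alcove_refl i m A k = - A j - m).
Proof.
move=> /[dup] d /and3P[ij jk ki] m A; rewrite /= /alcove_refl_coord eqxx.
rewrite [j == i]eq_sym (negPf ij) (negPf ki) -(distinct3E d).
by rewrite -(distinct3E (distinct3_flip d)).
Qed.

Lemma odd_alcove_refl i m A : odd_alcove (alcove_refl i m A) = ~~ odd_alcove A.
Proof.
have d := distinct3_shift i.
have := (sum_coord A d, sum_coord (alcove_refl i m A) d).
by rewrite !(alcove_reflE d); case: odd_alcove; case: odd_alcove => -[]; lia.
Qed.

Lemma alcove_reflK i m : involutive (alcove_refl i m).
Proof.
have d := distinct3_shift i.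
by move=> A; apply: (alcove_eq3 d); rewrite !(alcove_reflE d); lia.
Qed.

Lemma alcove_refl_conj i m j : exists i' m', forall A,
  alcove_refl j 0 (alcove_refl i m (alcove_refl j 0 A)) = alcove_refl i' m' A.
Proof.
have [->|ij] := eqVneq i j.
  have d := distinct3_shift j; exists j, (- m) => A.
  by apply: (alcove_eq3 d); rewrite !(alcove_reflE d); lia.
have := distinct3_third ij; move: (- (i + j)) => k d; exists k, (- 1 - m) => A.
have dj := distinct3_rot d; have dk := distinct3_rot dj.
have reflE := (alcove_reflE d, alcove_reflE dj, alcove_reflE dk).
by apply: (alcove_eq3 d); rewrite !reflE; lia.
Qed.

Lemma alcove_perm_subproof (t : 'S_3) A :
  \sum_l A (t l) \in [:: 0; 1].
Proof. by have := sum_coord01 A; rewrite (reindex_inj (@perm_inj _ t)). Qed.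

Definition alcove_perm t A : alcove := Alcove (alcove_perm_subproof t A).

Lemma alcove_permE t A i : alcove_perm t A i = A (t i).
Proof. by []. Qed.

Lemma alcove_permM t u A :
  alcove_perm t (alcove_perm u A) = alcove_perm (t * u)%g A.
Proof. by apply: alcove_eq => i; rewrite !alcove_permE permM. Qed.

Lemma alcove_perm1 A : alcove_perm 1 A = A.
Proof. by apply: alcove_eq => i; rewrite alcove_permE perm1. Qed.

Lemma alcove_perm_inj t : injective (alcove_perm t).
Proof.
apply: (can_inj (g := alcove_perm t^-1)) => A.
by rewrite alcove_permM mulVg alcove_perm1.
Qed.

Lemma alcove_perm0 t : alcove_perm t alcove0 = alcove0.
Proof. exact: alcove_eq. Qed.

Lemma alcove_refl_perm t i m A :
  alcove_perm t (alcove_refl (t i) m A) = alcove_refl i m (alcove_perm t A).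
Proof.
have d := distinct3_shift i; have dt := d; rewrite -(distinct3_permute t) in dt.
by apply: (alcove_eq3 d);
  rewrite !alcove_permE !(alcove_reflE d) !(alcove_reflE dt).
Qed.

Definition act_word (L : seq 'I_3) A : alcove :=
  foldr (fun i => alcove_refl i 0) A L.

Lemma act_wordE A : (act_word [::] A = A) *
  (forall i L, act_word (i :: L) A = alcove_refl i 0 (act_word L A)).
Proof. by []. Qed.

Lemma act_word_perm t L A :
  alcove_perm t (act_word (map t L) A) = act_word L (alcove_perm t A).
Proof.
by elim: L => // i L IH; rewrite map_cons !act_wordE alcove_refl_perm IH.
Qed.

Definition dominant_words (T : Type) (j k : T) : seq (seq T) :=
  [:: [::]; [:: j]; [:: k]; [:: j; k]; [:: k; j]; [:: j; k; j]].

Definition antidominant_words (T : Type) (i j k : T) : seq (seq T) :=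
  [:: [::]; [:: i]; [:: j; i]; [:: k; i]; [:: i; j; i]; [:: i; k; i]].

Definition strip_words (T : Type) (i j : T) : seq (seq T) :=
  [:: [::]; [:: i]; [:: j; i]; [:: i; j; i]].

Definition dominant_at i A : Prop := forall l, l != i -> 1 <= A l.

Definition antidominant_at i A : Prop :=
  forall l, l != i -> A l <= -1.

Definition opposite_at i A : Prop := forall l, l != i -> A l <= 0.

Lemma dominant_at_perm t i A :
  dominant_at i (alcove_perm t A) <-> dominant_at (t i) A.
Proof. exact: (forall_neq_perm (fun l => is_true (1 <= A l))). Qed.

Lemma antidominant_at_perm t i A :
  antidominant_at i (alcove_perm t A) <-> antidominant_at (t i) A.
Proof. exact: (forall_neq_perm (fun l => is_true (A l <= -1))). Qed.

Lemma opposite_at_perm t i A :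
  opposite_at i (alcove_perm t A) <-> opposite_at (t i) A.
Proof. exact: (forall_neq_perm (fun l => is_true (A l <= 0))). Qed.

Lemma dominant_at_refl i A :
  dominant_at i (alcove_refl i 0 A) <-> antidominant_at i A.
Proof.
have d := distinct3_shift i; split=> [/(forall_neq_distinct3 _ d)|].
  by rewrite !(alcove_reflE d) => ?; apply/(forall_neq_distinct3 _ d); lia.
move=> /(forall_neq_distinct3 _ d) ?; apply/(forall_neq_distinct3 _ d).
by rewrite !(alcove_reflE d); lia.
Qed.

Lemma alcove_eq0 A : (forall i, A i <= 0) -> A = alcove0.
Proof.
have i : 'I_3 := 0; have d := distinct3_shift i; have sA := sum_coord A d.
move=> A_le0; have := (A_le0 i, A_le0 (i + 1), A_le0 (i + 2)) => -[[? ?] ?].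
by apply: (alcove_eq3 d); rewrite alcove0E; case: odd_alcove sA; lia.
Qed.

Lemma exists_descent A : A <> alcove0 -> exists j, 1 <= A j.
Proof.
apply: contra_notP => no_descent; apply: alcove_eq0 => i; rewrite leNgt.
by apply/negP => Ai; apply: no_descent; exists i.
Qed.

Lemma opposite_at_gt0 i A : opposite_at i A -> A <> alcove0 -> 1 <= A i.
Proof.
move=> oA; apply: contra_notT; rewrite -ltNge => Ai; apply: alcove_eq0 => l.
by have [->|/oA] := eqVneq l i; [lia|].
Qed.

(** * The Bruhat order on alcoves *)

Definition alcove_length A : nat := (\sum_i `|A i|)%N.

Lemma alcove_lengthE A i j k : distinct3 i j k ->
  alcove_length A = (`|A i| + (`|A j| + `|A k|))%N.
Proof. exact: big_distinct3. Qed.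

Lemma alcove_length0 : alcove_length alcove0 = 0%N.
Proof. by rewrite /alcove_length big1. Qed.

Lemma alcove_length_eq0 A : alcove_length A = 0%N -> A = alcove0.
Proof.
move=> /eqP; rewrite sum_nat_eq0 => /forallP A0.
by apply: alcove_eq => i; apply/eqP; rewrite -absz_eq0; apply: A0.
Qed.

Lemma alcove_length_refl j A :
  if 1 <= A j then alcove_length A = (alcove_length (alcove_refl j 0 A)).+1
  else alcove_length (alcove_refl j 0 A) = (alcove_length A).+1.
Proof.
have d := distinct3_shift j; have := sum_coord A d.
rewrite !(alcove_lengthE _ d) !(alcove_reflE d).
by case: odd_alcove; case: ifP; lia.
Qed.

(* A reflection creating a descent at j raises the length by at least 3, unless
   it agrees with s_j on A. *)
Lemma alcove_exchange j i m A (C := alcove_refl i m A) :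
  A j <= 0 -> 1 <= C j -> (alcove_length A < alcove_length C)%N ->
  C = alcove_refl j 0 A \/
  (alcove_length (alcove_refl j 0 A) < alcove_length (alcove_refl j 0 C))%N.
Proof.
rewrite /C; have [->|ij] := eqVneq i j.
  have d := distinct3_shift j; have [->|m0] := eqVneq m 0; first by left.
  rewrite !(alcove_lengthE _ d) !(alcove_reflE d); right.
  by case: odd_alcove (sum_coord A d); lia.
have d := distinct3_third ij; have dj := distinct3_rot d.
rewrite !(alcove_lengthE _ d) !(alcove_reflE d, alcove_reflE dj) => Aj Cj len.
by right; case: odd_alcove (sum_coord A d); lia.
Qed.

Definition alcove_step A B : Prop :=
  (exists i m, B = alcove_refl i m A) /\ (alcove_length A < alcove_length B)%N.

Definition alcove_bruhat : alcove -> alcove -> Prop :=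
  clos_refl_trans alcove alcove_step.

Definition descend j A := if 1 <= A j then alcove_refl j 0 A else A.

Definition ascend j A := if 1 <= A j then A else alcove_refl j 0 A.

Lemma alcove_bruhat_length A B :
  alcove_bruhat A B -> (alcove_length A <= alcove_length B)%N.
Proof.
by elim=> // {}A {}B; [case=> _ /ltnW | move=> C _ AB _; apply: leq_trans].
Qed.

Lemma alcove_step_descend j A : 1 <= A j -> alcove_step (alcove_refl j 0 A) A.
Proof.
move=> Aj; split; first by exists j, 0; rewrite alcove_reflK.
by have := alcove_length_refl j A; rewrite Aj => ->.
Qed.

Lemma alcove_step_ascend j A :
  (1 <= A j) = false -> alcove_step A (alcove_refl j 0 A).
Proof.
move=> Aj; split; first by exists j, 0.
by have := alcove_length_refl j A; rewrite Aj => ->.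
Qed.

Lemma alcove_bruhat_descend j A :
  1 <= A j -> alcove_bruhat (alcove_refl j 0 A) A.
Proof. by move=> Aj; apply/rt_step/alcove_step_descend. Qed.

Lemma alcove_bruhat_ascend j A : alcove_bruhat A (ascend j A).
Proof.
rewrite /ascend; case: ifP => Aj; first exact: rt_refl.
exact/rt_step/alcove_step_ascend.
Qed.

Lemma ascend_refl j A : ascend j (alcove_refl j 0 A) = ascend j A.
Proof.
rewrite /ascend !(alcove_reflE (distinct3_shift j)) alcove_reflK.
by case: ifP; case: ifP => //; lia.
Qed.

Lemma ascend_descend j A : ascend j (descend j A) = ascend j A.
Proof. by rewrite /descend; case: ifP => // _; apply: ascend_refl. Qed.

Lemma alcove_step_refl j A C : alcove_step A C ->
  (alcove_length (alcove_refl j 0 A) < alcove_length (alcove_refl j 0 C))%N ->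
  alcove_step (alcove_refl j 0 A) (alcove_refl j 0 C).
Proof.
move=> [[i [m ->]] _] len; split=> //.
have [i' [m' conj]] := alcove_refl_conj i m j.
by exists i', m'; rewrite -conj alcove_reflK.
Qed.

Lemma alcove_step_lift j A C : alcove_step A C ->
  alcove_bruhat (descend j A) (descend j C) /\
  alcove_bruhat (ascend j A) (ascend j C).
Proof.
move=> AC; have [[i [m eC]] len] := AC.
have [lenA lenC] := (alcove_length_refl j A, alcove_length_refl j C).
have [sAA sCC] := (@alcove_step_descend j A, @alcove_step_descend j C).
have [AsA CsC] := (@alcove_step_ascend j A, @alcove_step_ascend j C).
rewrite /descend /ascend; case Aj : (1 <= A j) lenA sAA AsA;
  case Cj : (1 <= C j) lenC sCC CsC => lenC sCC CsC lenA sAA AsA.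
- by split; apply: rt_step => //; apply: alcove_step_refl => //; lia.
- split; first exact: rt_trans (rt_step _ _ _ _ (sAA _)) (rt_step _ _ _ _ AC).
  exact: rt_trans (rt_step _ _ _ _ AC) (rt_step _ _ _ _ (CsC _)).
- have := @alcove_exchange j i m A; rewrite -eC => -[|||->|lensC] //.
  + by lia.
  + by rewrite alcove_reflK; split; apply: rt_refl.
  have sAsC := alcove_step_refl AC lensC; split.
    exact: rt_trans (rt_step _ _ _ _ (AsA _)) (rt_step _ _ _ _ sAsC).
  exact: rt_trans (rt_step _ _ _ _ sAsC) (rt_step _ _ _ _ (sCC _)).
- by split; apply: rt_step => //; apply: alcove_step_refl => //; lia.
Qed.

Lemma alcove_bruhat_lift j A C : alcove_bruhat A C ->
  alcove_bruhat (descend j A) (descend j C) /\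
  alcove_bruhat (ascend j A) (ascend j C).
Proof.
elim=> [{}A {}C|{}A|{}A B {}C _ [dAB aAB] _ [dBC aBC]].
- exact: alcove_step_lift.
- by split; apply: rt_refl.
- by split; [apply: rt_trans dBC | apply: rt_trans aBC].
Qed.

(* The maximum of alpha_i - alpha_j over the centres of the alcoves below A. *)
Definition hexbound A (i j k : 'I_3) : int :=
  Num.max (A i - A j) (Num.max (A j - A k - 1) (A k - A i - 2)).

Definition hexle A B : Prop :=
  forall i j k, distinct3 i j k -> A i - A j <= hexbound B i j k.

Lemma hexlexx A : hexle A A.
Proof. by move=> i j k _; rewrite /hexbound le_max lexx. Qed.

Lemma hexle_perm t A B :
  hexle A B -> hexle (alcove_perm t A) (alcove_perm t B).
Proof. by move=> AB i j k d; apply: AB; rewrite distinct3_permute. Qed.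

Lemma hexleP A B i j k : distinct3 i j k -> hexle A B <->
  [/\ A i - A j <= hexbound B i j k, A j - A k <= hexbound B j k i
    & A k - A i <= hexbound B k i j] /\
  [/\ A i - A k <= hexbound B i k j, A k - A j <= hexbound B k j i
    & A j - A i <= hexbound B j i k].
Proof.
move=> d; split=> [AB|[[? ? ?] [? ? ?]]].
  have [dj dk] := (distinct3_rot d, distinct3_rot (distinct3_rot d)).
  by split; split; apply: AB; rewrite // distinct3_flip.
exact: distinct3_ind d _ _ _ _ _ _.
Qed.

Lemma hexle0x A : hexle alcove0 A.
Proof.
move=> i j k d; rewrite /hexbound !alcove0E.
by case: odd_alcove (sum_coord A d); lia.
Qed.

Lemma hexlex0 A : hexle A alcove0 -> A = alcove0.
Proof.
have i : 'I_3 := 0; have d := distinct3_shift i; have sA := sum_coord A d.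
move=> /(hexleP _ _ d); rewrite /hexbound !alcove0E => -[[? ? ?] [? ? ?]].
by apply: (alcove_eq3 d); rewrite alcove0E; case: odd_alcove sA; lia.
Qed.

Lemma hexbound_descent j k l B : distinct3 j k l -> 1 <= B j ->
  hexbound B j k l = hexbound B l j k + 1.
Proof.
by move=> d Bj; rewrite /hexbound; case: odd_alcove (sum_coord B d); lia.
Qed.

(* s_j exchanges alpha_j - alpha_k and alpha_l - alpha_j + 1, so the hexagon of
   B is symmetric under s_j when j is a descent of B. *)
Lemma hexle_refl_l j A B :
  1 <= B j -> hexle (alcove_refl j 0 A) B <-> hexle A B.
Proof.
have d := distinct3_shift j; have d' := distinct3_flip d.
move=> Bj; rewrite !(hexleP _ _ d) !(alcove_reflE d).
rewrite (hexbound_descent d Bj) (hexbound_descent d' Bj).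
by split=> -[[? ? ?] [? ? ?]]; split; split; lia.
Qed.

Lemma hexbound_refl j k l B : distinct3 j k l ->
  (hexbound (alcove_refl j 0 B) k l j = hexbound B k l j) *
  (hexbound (alcove_refl j 0 B) l j k = hexbound B l j k).
Proof. by move=> d; rewrite /hexbound !(alcove_reflE d); split; lia. Qed.

Lemma hexle_refl_r j A B : A j <= 0 -> 1 <= B j ->
  hexle A (alcove_refl j 0 B) <-> hexle A B.
Proof.
have d := distinct3_shift j; have d' := distinct3_flip d => Aj Bj.
rewrite !(hexleP _ _ d) !(hexbound_refl _ d) !(hexbound_refl _ d').
rewrite /hexbound !(alcove_reflE d) !le_max.
case: odd_alcove (sum_coord A d) => sA;
  case: odd_alcove (sum_coord B d) => sB;
  by split=> -[[? ? ?] [? ? ?]]; split; split; lia.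
Qed.

Lemma hexle_descend j A B : 1 <= B j ->
  hexle (descend j A) (alcove_refl j 0 B) <-> hexle A B.
Proof.
have d := distinct3_shift j; rewrite /descend; case: ifP => Aj Bj.
  by rewrite hexle_refl_r ?(alcove_reflE d) ?hexle_refl_l //; lia.
by apply: hexle_refl_r => //; lia.
Qed.

Theorem alcove_bruhatP A B : alcove_bruhat A B <-> hexle A B.
Proof.
have [n] := ubnP (alcove_length B); elim: n A B => // n IHn A B len.
have [->|B0] := pselect (B = alcove0).
  split=> [/alcove_bruhat_length|/hexlex0->]; last exact: rt_refl.
  rewrite alcove_length0 leqn0 => /eqP/alcove_length_eq0->.
  exact: hexlexx.
have [j Bj] := exists_descent B0; have := alcove_length_refl j B.
rewrite Bj => lenB; rewrite -(hexle_descend A Bj) -IHn; last by lia.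
split=> [/(alcove_bruhat_lift j)[+ _]|/(alcove_bruhat_lift j)[_]].
  by rewrite {2}/descend Bj.
rewrite ascend_descend ascend_refl [ascend j B]/ascend Bj.
exact/rt_trans/alcove_bruhat_ascend.
Qed.

Lemma hexle_act_word L B :
  (forall l, l \in L -> 1 <= B l) -> hexle (act_word L B) B.
Proof.
elim: L => [_|l L IH BL]; first exact: hexlexx.
rewrite act_wordE; apply/hexle_refl_l; first by apply: BL; rewrite mem_head.
by apply: IH => p Lp; apply: BL; rewrite inE Lp orbT.
Qed.

Lemma hexle_strip_words i j k B : distinct3 i j k -> 1 <= B i -> B k <= -1 ->
  {in strip_words i j, forall L, hexle (act_word L B) B}.
Proof.
move=> d Bi Bk L; have sjiB : hexle (act_word [:: j; i] B) B.
  apply/alcove_bruhatP; apply: rt_trans (alcove_bruhat_descend Bi).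
  by apply: alcove_bruhat_descend; rewrite (alcove_reflE d); lia.
rewrite !inE => /or4P[] /eqP-> //; last exact/hexle_refl_l.
- exact: hexlexx.
- by apply: hexle_act_word => l; rewrite inE => /eqP->.
Qed.

Lemma hexle_antidominant_words i j k B :
  distinct3 i j k -> antidominant_at i B ->
  {in antidominant_words i j k, forall L, hexle (act_word L B) B}.
Proof.
move=> d /(forall_neq_distinct3 _ d)[Bj Bk] L L_in.
have Bi : 1 <= B i by case: odd_alcove (sum_coord B d); lia.
have [L_ij|L_ik] : L \in strip_words i j \/ L \in strip_words i k.
  move: L_in; rewrite !inE.
  by do 5?[case/orP]; move=> /eqP->; rewrite !eqxx ?orbT; auto.
- exact: (hexle_strip_words d).
- exact: (hexle_strip_words (distinct3_flip d)).
Qed.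
Variant alcove_spec A : Prop :=
| alcove_spec_id of A = alcove0
| alcove_spec_s i of A = alcove_refl i 0 alcove0
| alcove_spec_dominant i of dominant_at i A
| alcove_spec_antidominant i of antidominant_at i A
| alcove_spec_strip i j k of
    distinct3 i j k & 1 <= A i & A j = 0 & A k <= -1.

Lemma alcove_case A : alcove_spec A.
Proof.
have [/alcove_spec_id//|A0] := pselect (A = alcove0).
have [i Ai] := exists_descent A0; have d := distinct3_shift i.
move: (i + 1) (i + 2) d => j k d; have sA := sum_coord A d.
have dj := distinct3_rot d; have dk := distinct3_rot dj.
have [Aj|Aj] := leP 1 (A j).
  by apply: (@alcove_spec_dominant _ k); apply/(forall_neq_distinct3 _ dk).
have [Ak|Ak] := leP 1 (A k).
  by apply: (@alcove_spec_dominant _ j); apply/(forall_neq_distinct3 _ dj).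
have [Aj0|Aj0] := eqVneq (A j) 0; have [Ak0|Ak0] := eqVneq (A k) 0.
- apply: (@alcove_spec_s _ i); apply: (alcove_eq3 d);
    by rewrite !(alcove_reflE d) !alcove0E; case: odd_alcove sA; lia.
- by apply: alcove_spec_strip d _ _ _ => //; lia.
- by apply: alcove_spec_strip (distinct3_flip d) _ _ _ => //; lia.
- apply: (@alcove_spec_antidominant _ i).
  by apply/(forall_neq_distinct3 _ d); lia.
Qed.

(** * Corners of hexagons *)

Definition source_corner B i Z : Prop :=
  forall j k, distinct3 i j k -> Z i - Z j = hexbound B i j k.

Definition sink_corner B j Z : Prop :=
  forall i k, distinct3 i j k -> Z i - Z j = hexbound B i j k.

Lemma source_cornerP B Z i j k : distinct3 i j k ->
  Z i - Z j = hexbound B i j k -> Z i - Z k = hexbound B i k j ->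
  source_corner B i Z.
Proof.
by move=> d Zj Zk l m /(distinct3_completion d)[] [-> ->].
Qed.

Lemma sink_cornerP B Z i j k : distinct3 i j k ->
  Z j - Z i = hexbound B j i k -> Z k - Z i = hexbound B k i j ->
  sink_corner B i Z.
Proof.
move=> d Zj Zk l m /distinct3_rot/distinct3_flip.
by move=> /(distinct3_completion d)[] [-> ->].
Qed.

Definition contains_corners (K : set alcove) B : Prop := forall i,
  (exists2 Z, K Z & source_corner B i Z) /\
  (exists2 Z, K Z & sink_corner B i Z).

Lemma simple_corners (K : set alcove) i (B := alcove_refl i 0 alcove0) :
  K alcove0 -> K B -> contains_corners K B.
Proof.
move=> K0 KB l; have d := distinct3_shift i.
have dj := distinct3_rot d; have dk := distinct3_rot dj.
have [->|->|->] := distinct3_cover l d; split;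
  [exists B | exists alcove0 | exists alcove0 | exists B
  |exists alcove0 | exists B] => //;
  [apply: (source_cornerP d) | apply: (sink_cornerP d)
  |apply: (source_cornerP dj) | apply: (sink_cornerP dj)
  |apply: (source_cornerP dk) | apply: (sink_cornerP dk)];
  by rewrite /hexbound /B !(alcove_reflE d) !alcove0E; lia.
Qed.

Lemma dominant_corners (K : set alcove) B i j k :
  distinct3 i j k -> dominant_at i B ->
  {in dominant_words j k, forall L, K (act_word L B)} ->
  contains_corners K B.
Proof.
move=> d dB KB l; have dj := distinct3_rot d; have dk := distinct3_rot dj.
have reflE := (alcove_reflE dj, alcove_reflE dk).
have [sB [Bj Bk]] := (sum_coord B d, (forall_neq_distinct3 _ d).1 dB).
have [->|->|->] := distinct3_cover l d; split;
  [exists (act_word [:: j; k; j] B) | exists (act_word [::] B)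
  |exists (act_word [:: k] B) | exists (act_word [:: j; k] B)
  |exists (act_word [:: j] B) | exists (act_word [:: k; j] B)];
  do ?[by apply: KB; rewrite !inE eqxx ?orbT];
  [apply: (source_cornerP d) | apply: (sink_cornerP d)
  |apply: (source_cornerP dj) | apply: (sink_cornerP dj)
  |apply: (source_cornerP dk) | apply: (sink_cornerP dk)];
  by rewrite !act_wordE ?reflE /hexbound; case: odd_alcove sB; lia.
Qed.

Lemma antidominant_corners (K : set alcove) B i j k :
  distinct3 i j k -> antidominant_at i B ->
  {in antidominant_words i j k, forall L, K (act_word L B)} ->
  contains_corners K B.
Proof.
move=> d aB KB l; have dj := distinct3_rot d; have dk := distinct3_rot dj.
have reflE := (alcove_reflE d, alcove_reflE dj, alcove_reflE dk).
have [sB [Bj Bk]] := (sum_coord B d, (forall_neq_distinct3 _ d).1 aB).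
have [->|->|->] := distinct3_cover l d; split;
  [exists (act_word [::] B) | exists (act_word [:: i] B)
  |exists (act_word [:: k; i] B) | exists (act_word [:: i; j; i] B)
  |exists (act_word [:: j; i] B) | exists (act_word [:: i; k; i] B)];
  do ?[by apply: KB; rewrite !inE eqxx ?orbT];
  [apply: (source_cornerP d) | apply: (sink_cornerP d)
  |apply: (source_cornerP dj) | apply: (sink_cornerP dj)
  |apply: (source_cornerP dk) | apply: (sink_cornerP dk)];
  by rewrite !act_wordE ?reflE /hexbound; case: odd_alcove sB; lia.
Qed.

Lemma strip_corners (K : set alcove) B i j k :
  distinct3 i j k -> 1 <= B i -> B j = 0 -> B k <= -1 ->
  {in strip_words i j, forall L, K (act_word L B)} ->
  contains_corners K B.
Proof.
move=> d Bi Bj Bk KB l; have dj := distinct3_rot d; have dk := distinct3_rot dj.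
have reflE := (alcove_reflE d, alcove_reflE dj); have sB := sum_coord B d.
have [->|->|->] := distinct3_cover l d; split;
  [exists (act_word [::] B) | exists (act_word [:: i] B)
  |exists (act_word [:: i] B) | exists (act_word [:: i; j; i] B)
  |exists (act_word [:: j; i] B) | exists (act_word [::] B)];
  do ?[by apply: KB; rewrite !inE eqxx ?orbT];
  [apply: (source_cornerP d) | apply: (sink_cornerP d)
  |apply: (source_cornerP dj) | apply: (sink_cornerP dj)
  |apply: (source_cornerP dk) | apply: (sink_cornerP dk)];
  by rewrite !act_wordE ?reflE /hexbound; case: odd_alcove sB; lia.
Qed.

(** * Alcoves not above a given one *)

Lemma dominant_or_opposite A : A <> alcove0 ->
  exists i, dominant_at i A \/ opposite_at i A.
Proof.
move=> /exists_descent[i Ai]; have d := distinct3_shift i.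
have dj := distinct3_rot d; have dk := distinct3_rot dj.
have [Aj|Aj] := leP 1 (A (i + 1)).
  by exists (i + 2); left; apply/(forall_neq_distinct3 _ dk).
have [Ak|Ak] := leP 1 (A (i + 2)).
  by exists (i + 1); left; apply/(forall_neq_distinct3 _ dj).
by exists i; right; apply/(forall_neq_distinct3 _ d); lia.
Qed.

Lemma dominant_at_uniq i j A : dominant_at i A -> dominant_at j A -> i = j.
Proof.
move=> dAi dAj; apply/eqP/contraT => /[dup] ij /distinct3_third d.
have [? ?] := (forall_neq_distinct3 _ d).1 dAi; have ? := dAj i ij.
by case: odd_alcove (sum_coord A d); lia.
Qed.

Lemma opposite_at_uniq i j A :
  A <> alcove0 -> opposite_at i A -> opposite_at j A -> i = j.
Proof.
move=> A0 oAi oAj; apply/eqP/contraT => ij.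
by have := oAj i ij; have := opposite_at_gt0 oAi A0; lia.
Qed.

Lemma dominant_not_opposite i j A : dominant_at i A -> ~ opposite_at j A.
Proof.
have d := distinct3_shift i.
move=> /(forall_neq_distinct3 _ d)[A1 A2] oA.
have [e|ne] := eqVneq (i + 1) j; last by have := oA _ ne; lia.
have ne : i + 2 != j by rewrite -e eq_sym; case/and3P: d.
by have := oA _ ne; lia.
Qed.

Lemma not_hexle X Z : ~ hexle X Z <->
  exists i j k, distinct3 i j k /\ hexbound Z i j k < X i - X j.
Proof.
split=> [nle|[i [j [k [d lt]]]] /(_ _ _ _ d)]; last by rewrite leNgt lt.
apply: contrapT => nex; apply: nle => i j k d; rewrite leNgt.
by apply/negP => lt; apply: nex; exists i, j, k.
Qed.

Lemma not_hexle_dominant X Z i j k : distinct3 i j k -> dominant_at i X ->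
  ~ hexle X Z <->
  hexbound Z j i k < X j - X i \/ hexbound Z k i j < X k - X i.
Proof.
move=> d /(forall_neq_distinct3 _ d)[Xj Xk]; have sX := sum_coord X d.
rewrite not_hexle; split=> [[l [m [n [dlmn]]]]|[lt|lt]]; first last.
- by exists k, i, j; split; first exact: distinct3_rot (distinct3_rot d).
- by exists j, i, k; split; first exact: distinct3_flip (distinct3_rot d).
move: l m n dlmn; apply: (distinct3_ind d); rewrite /hexbound !gt_max;
  by case: odd_alcove sX; lia.
Qed.

Lemma not_hexle_opposite X Z i j k :
  distinct3 i j k -> opposite_at i X -> X <> alcove0 ->
  ~ hexle X Z <->
  hexbound Z i j k < X i - X j \/ hexbound Z i k j < X i - X k.
Proof.
move=> d oX /(opposite_at_gt0 oX) Xi.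
have [Xj Xk] := (forall_neq_distinct3 _ d).1 oX.
have [sX sZ] := (sum_coord X d, sum_coord Z d).
rewrite not_hexle; split=> [[l [m [n [dlmn]]]]|[lt|lt]]; first last.
- by exists i, k, j; split; first exact: distinct3_flip.
- by exists i, j, k.
move: l m n dlmn; apply: (distinct3_ind d); rewrite /hexbound !gt_max;
  by case: odd_alcove sX; case: odd_alcove sZ; lia.
Qed.

(** * Sets and convexity *)

Lemma set_cons (T : eqType) (x : T) (L : seq T) :
  [set` x :: L] = x |` [set` L].
Proof.
by apply/predeqP => y; rewrite /= inE; apply: iff_sym (rwP predU1P).
Qed.

Lemma image_strip_words (T : eqType) (U : Type) (f : seq T -> U) i j :
  [set f L | L in [set` strip_words i j]] =
  [set f [::]; f [:: i]; f [:: j; i]; f [:: i; j; i]].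
Proof.
by rewrite !set_cons set_nil setU0 !image_setU !image_set1 !setUA.
Qed.

Lemma image_antidominant_words (T : eqType) (U : Type) (f : seq T -> U) i j k :
  [set f L | L in [set` antidominant_words i j k]] =
  [set f [::]; f [:: i]; f [:: j; i]; f [:: k; i]; f [:: i; j; i];
       f [:: i; k; i]].
Proof.
by rewrite !set_cons set_nil setU0 !image_setU !image_set1 !setUA.
Qed.

Section Plane.
Variable R : realType.

Local Notation E := 'rV[R]_2.

Lemma dotBr (a u v : E) : dot a (u - v) = dot a u - dot a v.
Proof. by rewrite dotDr dotNr. Qed.

Lemma dotNl (u v : E) : dot (- u) v = - dot u v.
Proof. by rewrite dotC dotNr dotC. Qed.

Lemma invf_can (f g : E -> E) : cancel f g -> cancel g f -> invf f = g.
Proof.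
move=> fK gK; apply/funext => v; rewrite /invf.
by case: xgetP => [u _ <-|/(_ (g v))]; rewrite ?fK //= gK.
Qed.

Lemma conjf_id : conjf id = id :> ((E -> E) -> (E -> E)).
Proof. by apply/funext => w; rewrite /conjf (@invf_can id id). Qed.

Lemma dot_continuous (u : E) : continuous (dot u).
Proof.
have -> : dot u = (fun v => u ord0 ord0 * v ord0 ord0 +
    u ord0 ord_max * v ord0 ord_max) by apply/funext => v; rewrite dotE.
move=> v; apply: (@cvgD _ _ _ (nbhs v)); apply: (@cvgMl_tmp _ _ (nbhs v));
  exact: coord_continuous.
Qed.

Lemma convex_setP (M : lmodType R) (K : set M) : @convex_set R M K <->
  forall p q t, 0 <= t <= 1 -> K p -> K q -> K (t *: p + (1 - t) *: q).
Proof.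
split=> [cK p q t /andP[t0 t1] Kp Kq|cK p q t /set_mem Kp /set_mem Kq].
  exact: set_mem (cK p q (Itv01 t0 t1) (mem_set Kp) (mem_set Kq)).
by apply/mem_set; apply: (cK p q t%:num) => //; rewrite ge0 le1.
Qed.

Lemma convex_convex_hull (S : set E) : @convex_set R E (convex_hull S).
Proof.
apply/convex_setP => p q t t01 Sp Sq K [cK SK].
by move/convex_setP: (cK); apply=> //; [apply: Sp | apply: Sq].
Qed.

Lemma interior_translate (V : normedModType R) (K : set V) (v u : V) :
  interior K v -> exists2 t : R, 0 < t & K (v + t *: u).
Proof.
move=> Kv; have cont : {for 0, continuous (fun t : R => v + t *: u)}.
  by apply: cvgD; [apply: cvg_cst | apply: scalel_continuous].
have : nbhs (0 : R) ((fun t : R => v + t *: u) @^-1` K).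
  by apply: cont; rewrite /= scale0r addr0.
case/nbhs_ballP => e /= e0 Ke; exists (e / 2); first by rewrite divr_gt0.
apply: Ke; rewrite /ball /= sub0r normrN gtr0_norm ?divr_gt0 //.
by rewrite ltr_pdivrMr //; lra.
Qed.

End Plane.

(** * Affine roots and the action of the affine Weyl group *)

Section AffineRoots.
Variables (R : realType) (P : rootsA2 R).

Local Notation E := 'rV[R]_2.

Let dot_alpha := (dot_alpha11 P, dot_alpha22 P, dot_alpha12 P,
  dotC (alpha2 P) (alpha1 P)).

Let dot_varpi := (dotC (alpha1 P) (varpi1 P), dotC (alpha2 P) (varpi1 P),
  dotC (alpha1 P) (varpi2 P), dotC (alpha2 P) (varpi2 P),
  dot_varpi11 P, dot_varpi12 P, dot_varpi21 P, dot_varpi22 P).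

Definition aroot (i : 'I_3) (v : E) : R :=
  match i : nat with
  | 0%N => - dot (rho P) v - 1
  | 1%N => dot (alpha1 P) v
  | _ => dot (alpha2 P) v
  end.

Lemma sum_aroot v : \sum_i aroot i v = -1.
Proof.
rewrite (big_distinct3 +%R (fun i => aroot i v) (isT : distinct3 0 1 2)) /=.
by rewrite /aroot /= dotDl; ring.
Qed.

Lemma sum_aroot_inj (f : 'I_3 -> 'I_3) v :
  injective f -> \sum_i aroot (f i) v = -1.
Proof. by move=> f_inj; rewrite -(sum_aroot v) [RHS](reindex_inj f_inj). Qed.

Lemma sum_aroot3 v i j k :
  distinct3 i j k -> aroot i v + (aroot j v + aroot k v) = -1.
Proof. by move=> d; rewrite -(sum_aroot v) (big_distinct3 _ _ d). Qed.

Lemma aroot_inj u v : (forall i, aroot i u = aroot i v) -> u = v.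
Proof.
by move=> uv; apply: (@dot_inj R P); [apply: (uv 1) | apply: (uv 2)].
Qed.

Lemma aroot_inj2 u v i j k : distinct3 i j k ->
  aroot i u = aroot i v -> aroot j u = aroot j v -> u = v.
Proof.
move=> d eu ev; apply: aroot_inj => l.
have := sum_aroot3 u d; have := sum_aroot3 v d.
by have [->|->|->] := distinct3_cover l d; lra.
Qed.

Lemma aroot_comb (t : R) u v i :
  aroot i (t *: u + (1 - t) *: v) = t * aroot i u + (1 - t) * aroot i v.
Proof.
by rewrite /aroot; case: (i : nat) => [|[|?]]; rewrite dotDr !dotZr //; ring.
Qed.

Definition point (x : 'I_3 -> R) : E := x 1 *: varpi1 P + x 2 *: varpi2 P.

Lemma dot_alpha_point x :
  (dot (alpha1 P) (point x) = x 1) * (dot (alpha2 P) (point x) = x 2).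
Proof. by rewrite !dotDr !dotZr !dot_varpi; split; ring. Qed.

Lemma aroot_translate v x t i : \sum_l x l = 0 ->
  aroot i (v + t *: point x) = aroot i v + t * x i.
Proof.
rewrite (big_distinct3 _ _ (isT : distinct3 0 1 2)) /= => /eqP.
rewrite addr_eq0 => /eqP x0.
elim/ord3_ind: i; rewrite /aroot /= ?dotDl !(dotDr _ v) !dotZr;
  by rewrite !dot_alpha_point ?x0 //; ring.
Qed.

Lemma aroot_point x i : \sum_l x l = -1 -> aroot i (point x) = x i.
Proof.
rewrite (big_distinct3 _ _ (isT : distinct3 0 1 2)) /= => sx.
have x0 : x 0 = - (x 1 + x 2) - 1 by rewrite -sx; ring.
by elim/ord3_ind: i; rewrite /aroot /= ?dotDl !dot_alpha_point ?x0.
Qed.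

Definition aroot_refl_coord (i : 'I_3) (m : int) (v : E) (l : 'I_3) : R :=
  if l == i then 2 * m%:~R - aroot i v else - 1 - aroot (- (i + l)) v - m%:~R.

Definition aroot_refl i m (v : E) : E := point (aroot_refl_coord i m v).

Lemma aroot_reflE i j k : distinct3 i j k -> forall m v,
  (aroot i (aroot_refl i m v) = 2 * m%:~R - aroot i v) *
  (aroot j (aroot_refl i m v) = - 1 - aroot k v - m%:~R) *
  (aroot k (aroot_refl i m v) = - 1 - aroot j v - m%:~R).
Proof.
move=> /[dup] d /and3P[ij jk ki] m v.
have coordE : (aroot_refl_coord i m v i = 2 * m%:~R - aroot i v) *
    (aroot_refl_coord i m v j = - 1 - aroot k v - m%:~R) *
    (aroot_refl_coord i m v k = - 1 - aroot j v - m%:~R).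
  rewrite /aroot_refl_coord eqxx [j == i]eq_sym (negPf ij) (negPf ki).
  by rewrite -(distinct3E d) -(distinct3E (distinct3_flip d)).
have sum_refl : \sum_l aroot_refl_coord i m v l = -1.
  by rewrite (big_distinct3 _ _ d) /= !coordE; have := sum_aroot3 v d; lra.
by rewrite /aroot_refl !aroot_point ?coordE.
Qed.

Lemma aroot_reflK i m : involutive (aroot_refl i m).
Proof.
have d := distinct3_shift i.
by move=> v; apply: (aroot_inj2 d); rewrite !(aroot_reflE d); ring.
Qed.

Lemma s_aroot_refl i : s P i = aroot_refl i%:R 0.
Proof.
have -> : s P i = s P (i%:R : 'I_3) by rewrite /s Zp_nat /= modn_mod.
apply/funext => v; apply: (@dot_inj R P);
  rewrite dot_alpha_point /aroot_refl_coord; elim/ord3_ind: i%:R => /=;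
  rewrite /s /refl /= dotBr dotZr ?(dotDl, dotDr) ?dot_alpha /aroot /=;
  by rewrite ?dotDl; field.
Qed.

Definition diagram_isom (t : 'S_3) (v : E) : E :=
  point (fun l => aroot (t l) v).

Lemma aroot_diagram_isom t v i : aroot i (diagram_isom t v) = aroot (t i) v.
Proof. by rewrite aroot_point //; apply/sum_aroot_inj/perm_inj. Qed.

Lemma diagram_isomM t u :
  diagram_isom t \o diagram_isom u = diagram_isom (t * u)%g.
Proof.
apply/funext => v; apply: aroot_inj => i.
by rewrite /= !aroot_diagram_isom permM.
Qed.

Lemma diagram_isom1 : diagram_isom 1 = id.
Proof.
by apply/funext => v; apply: aroot_inj => i; rewrite aroot_diagram_isom perm1.
Qed.

Lemma diagram_isomK t : cancel (diagram_isom t) (diagram_isom t^-1).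
Proof.
by apply/funeqP; rewrite -[LHS]/(_ \o _) diagram_isomM mulVg diagram_isom1.
Qed.

Lemma deltaE : delta P = diagram_isom (shift3 1).
Proof.
apply/funext => v; apply: aroot_inj.
elim/ord3_ind; rewrite aroot_diagram_isom permE /aroot /=.
- by rewrite dotr_delta; ring.
- by rewrite dot1_delta; ring.
- by rewrite dot2_delta.
Qed.

Lemma iter_delta n : iter n (delta P) = diagram_isom (shift3 n%:R).
Proof.
elim: n => [|n IH].
  apply/funext => v; apply: aroot_inj => i.
  by rewrite aroot_diagram_isom permE subr0.
by rewrite -natr1 addrC -shift3D -diagram_isomM -deltaE -IH.
Qed.

Lemma sigmaE : sigma P = diagram_isom opp3.
Proof.
apply/funext => v; apply: aroot_inj.
elim/ord3_ind; rewrite aroot_diagram_isom permE /aroot /= /sigma;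
  by rewrite dotBr dotZr !(dotDl, dotDr) !dot_alpha; field.
Qed.

Definition color A : 'I_3 := (A 1 - A 2)%:~R.

Lemma intr_mul3 (x : int) : (3 * x)%:~R = 0 :> 'I_3.
Proof. by rewrite intrM (_ : 3%:~R = 0) ?mul0r //; apply/val_inj. Qed.

Lemma color_refl i m A : color (alcove_refl i m A) =
  if odd_alcove A then color A - i else color A + i.
Proof.
have d : distinct3 0 1 2 by [].
have [d' d''] := (distinct3_rot d, distinct3_rot (distinct3_rot d)).
have mod3 (x y z e : int) (xyz : x = y + e + 3 * z) :
    (x%:~R : 'I_3) = y%:~R + e%:~R.
  by rewrite xyz !intrD intr_mul3 addr0.
have sA := sum_coord A d; rewrite /color; elim/ord3_ind: i.
- by rewrite !(alcove_reflE d) subr0 addr0 if_same; congr (_%:~R); lia.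
- rewrite !(alcove_reflE d'); case: odd_alcove sA => sA.
    by apply: (mod3 _ _ (m - A 1 + 1) (-1)); lia.
  by apply: (mod3 _ _ (m - A 1) 1); lia.
- rewrite !(alcove_reflE d''); case: odd_alcove sA => sA.
    by apply: (mod3 _ _ (A 2 - m) (-2)); lia.
  by apply: (mod3 _ _ (A 2 - m - 1) 2); lia.
Qed.

Definition linear_part A (l : 'I_3) : 'I_3 :=
  if odd_alcove A then - l - color A else l - color A.

Lemma linear_part_inj A : injective (linear_part A).
Proof.
by rewrite /linear_part; case: odd_alcove => i j /addIr // /oppr_inj.
Qed.

Lemma linear_part_surj A j : exists i, linear_part A i = j.
Proof. by exists (invF (@linear_part_inj A) j); rewrite f_invF. Qed.

Lemma distinct3_linear_part A i j k :
  distinct3 (linear_part A i) (linear_part A j) (linear_part A k) =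
  distinct3 i j k.
Proof. by rewrite /distinct3 !(inj_eq (@linear_part_inj A)). Qed.

Lemma linear_part_refl i m A l :
  linear_part (alcove_refl i m A) l = linear_part A (- (i + l)).
Proof.
rewrite /linear_part odd_alcove_refl color_refl.
by case: odd_alcove => /=; ring.
Qed.

Definition weyl_elt_coord A (v : E) (l : 'I_3) : R :=
  if odd_alcove A then (A l)%:~R - 1 - aroot (linear_part A l) v
  else (A l)%:~R + aroot (linear_part A l) v.

(* The element of W mapping A_+ to A: up to sign its linear part permutes the
   linear parts of the affine roots, by a permutation of 'Z_3 that depends only
   on the parity and the color of A. *)
Definition weyl_elt A (v : E) : E := point (weyl_elt_coord A v).

Lemma aroot_weyl_elt A v l : aroot l (weyl_elt A v) = weyl_elt_coord A v l.
Proof.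
have intr_sum : \sum_i (A i)%:~R = (\sum_i A i)%:~R :> R.
  by rewrite (raddf_sum (intr : int -> R)).
have sum_root := sum_aroot_inj _ (@linear_part_inj A).
rewrite aroot_point // /weyl_elt_coord /odd_alcove.
have := sum_coord01 A; rewrite !inE => /orP[] /eqP eA; rewrite eA /=.
  by rewrite big_split /= intr_sum eA sum_root add0r.
by rewrite !sumrB sum_root intr_sum eA sumr_const card_ord; ring.
Qed.

Lemma weyl_elt0 : weyl_elt alcove0 = id.
Proof.
apply/funext => v; apply: aroot_inj => l; rewrite aroot_weyl_elt.
by rewrite /weyl_elt_coord /linear_part odd_alcove0 add0r subr0.
Qed.

Lemma weyl_elt_alcove_refl i m A :
  weyl_elt (alcove_refl i m A) = aroot_refl i m \o weyl_elt A.
Proof.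
have := distinct3_shift i; move: (i + 1) (i + 2) => j k d.
have third_i : - (i + i) = i by elim/ord3_ind: (i); apply/val_inj.
have [third_k third_j] := (distinct3E d, distinct3E (distinct3_flip d)).
apply/funext => v; apply: aroot_inj => l.
rewrite aroot_weyl_elt /weyl_elt_coord odd_alcove_refl linear_part_refl.
have [->|->|->] := distinct3_cover l d;
  rewrite ?third_i -?third_j -?third_k !(alcove_reflE d) !(aroot_reflE d);
  rewrite !aroot_weyl_elt /weyl_elt_coord;
  by case: odd_alcove => /=; rewrite ?(intrD, intrB, intrM, intrN); ring.
Qed.

Definition word_alcove (L : seq nat) : alcove :=
  act_word [seq i%:R | i <- L] alcove0.

Lemma word_alcove_cons i L :
  word_alcove (i :: L) = alcove_refl i%:R 0 (word_alcove L).
Proof. by []. Qed.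

Lemma prods_weyl_elt L A :
  prods P L \o weyl_elt A = weyl_elt (act_word [seq i%:R | i <- L] A).
Proof.
by elim: L => //= i L IH; rewrite weyl_elt_alcove_refl -IH -s_aroot_refl.
Qed.

Lemma prods_word L : prods P L = weyl_elt (word_alcove L).
Proof. by rewrite -prods_weyl_elt weyl_elt0. Qed.

Lemma alcove_length_word L : (alcove_length (word_alcove L) <= size L)%N.
Proof.
elim: L => [|i L IH]; first by rewrite alcove_length0.
rewrite word_alcove_cons.
by have := alcove_length_refl i%:R (word_alcove L); case: ifP => _ /=; lia.
Qed.

Lemma reduced_word A :
  exists2 L, word_alcove L = A & size L = alcove_length A.
Proof.
have [n] := ubnP (alcove_length A); elim: n A => // n IHn A len.
have [->|A0] := pselect (A = alcove0).
  by exists [::]; rewrite ?alcove_length0.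
have [j Aj] := exists_descent A0.
have := alcove_length_refl j A; rewrite Aj => lenA.
have [|L eL sL] := IHn (alcove_refl j 0 A); first by lia.
exists ((j : nat) :: L); last by rewrite /= sL lenA.
by rewrite word_alcove_cons eL natr_Zp alcove_reflK.
Qed.

Lemma W_weyl_elt A : W P (weyl_elt A).
Proof. by have [L <- _] := reduced_word A; exists L; rewrite prods_word. Qed.

Lemma WP w : W P w <-> exists A, w = weyl_elt A.
Proof.
split=> [[L ->]|[A ->]]; last exact: W_weyl_elt.
by exists (word_alcove L); apply: prods_word.
Qed.

Lemma aroot_vertices l :
  aroot l 0 + aroot l (- varpi1 P) + aroot l (- varpi2 P) = -1.
Proof.
have dot0 a : dot a 0 = 0 :> R by rewrite -(scale0r 0) dotZr mul0r.
by elim/ord3_ind: l; rewrite /aroot /= !dot0 ?dotDl !dotNr !dot_varpi; ring.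
Qed.

Lemma aroot_cen A l :
  aroot l (cen P (weyl_elt A)) = (A l)%:~R - (1 + (odd_alcove A)%:R) / 3.
Proof.
have avg u v w : aroot l (3^-1 *: (u + v + w)) =
    3^-1 * (aroot l u + aroot l v + aroot l w).
  by rewrite /aroot; case: (l : nat) => [|[|?]]; rewrite dotZr !dotDr //; field.
rewrite /cen avg !aroot_weyl_elt /weyl_elt_coord.
by have := aroot_vertices (linear_part A l); case: odd_alcove => /=; lra.
Qed.

Lemma aroot_cenB A i j :
  aroot i (cen P (weyl_elt A)) - aroot j (cen P (weyl_elt A)) =
  (A i - A j)%:~R.
Proof. by rewrite !aroot_cen intrB; ring. Qed.

Lemma cen_weyl_elt_inj : injective (cen P \o weyl_elt).
Proof.
move=> A B /= eAB; have diff i j : A i - A j = B i - B j.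
  by apply: (@intr_inj R); rewrite -!aroot_cenB eAB.
have i : 'I_3 := 0; have d := distinct3_shift i.
have [diff1 diff2] := (diff i (i + 1), diff i (i + 2)).
have [sA sB] := (sum_coord A d, sum_coord B d).
apply: (alcove_eq3 d);
  by case: odd_alcove sA; case: odd_alcove sB; lia.
Qed.

Lemma weyl_elt_inj : injective weyl_elt.
Proof. by move=> A B eAB; apply: cen_weyl_elt_inj; rewrite /= eAB. Qed.

Lemma ell_weyl_elt A : ell P (weyl_elt A) = alcove_length A.
Proof.
have [L eL sL] := reduced_word A.
have minimal L' : weyl_elt A = prods P L' -> (alcove_length A <= size L')%N.
  by rewrite prods_word => /weyl_elt_inj->; apply: alcove_length_word.
rewrite /ell; case: xgetP => [n _ [[L' <- eL'] min]|/(_ (alcove_length A)) []].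
  by apply/eqP; rewrite eqn_leq minimal // -sL min // prods_word eL.
by split=> //; exists L; rewrite // prods_word eL.
Qed.

Lemma weyl_elt_refl A i m : weyl_elt A \o aroot_refl (linear_part A i) m =
  aroot_refl i (if odd_alcove A then A i - 1 - m else A i + m) \o weyl_elt A.
Proof.
have d := distinct3_shift i; have dl := d.
rewrite -(distinct3_linear_part A) in dl.
have sA := congr1 (intr : int -> R) (sum_coord A d).
apply/funext => v; apply: (aroot_inj2 d); rewrite /= aroot_weyl_elt;
  rewrite (aroot_reflE d) aroot_weyl_elt /weyl_elt_coord (aroot_reflE dl);
  by case: odd_alcove sA; rewrite /= ?(intrB, intrD, intrN) => sA; lra.
Qed.

Lemma refl_weyl_elt A i m : exists m',
  aroot_refl i m \o weyl_elt A = weyl_elt A \o aroot_refl (linear_part A i) m'.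
Proof.
exists (if odd_alcove A then A i - 1 - m else m - A i); rewrite weyl_elt_refl.
by case: odd_alcove; congr (aroot_refl _ _ \o _); ring.
Qed.

Lemma prods_cat L M : prods P (L ++ M) = prods P L \o prods P M.
Proof. by elim: L => //= i L ->. Qed.

Lemma prods_revK L : cancel (prods P (rev L)) (prods P L).
Proof.
elim: L => //= i L IH v; rewrite rev_cons -cats1 prods_cat /= IH.
by rewrite s_aroot_refl aroot_reflK.
Qed.

Lemma invf_prods L : invf (prods P L) = prods P (rev L).
Proof. by apply: invf_can; [rewrite -{1}[L]revK|]; apply: prods_revK. Qed.

Lemma W_comp u v : W P u -> W P v -> W P (u \o v).
Proof. by move=> [L ->] [M ->]; exists (L ++ M); rewrite prods_cat. Qed.

Lemma W_invf u : W P u -> W P (invf u).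
Proof. by move=> [L ->]; exists (rev L); apply: invf_prods. Qed.

Lemma W_compV u : W P u -> u \o invf u = id.
Proof.
by move=> [L ->]; apply/funext => v; rewrite invf_prods /= prods_revK.
Qed.

Lemma invf_invf u : W P u -> invf (invf u) = u.
Proof. by move=> [L ->]; rewrite !invf_prods revK. Qed.

Lemma invf_comp u v : W P u -> W P v -> invf (u \o v) = invf v \o invf u.
Proof.
by move=> [L ->] [M ->]; rewrite -prods_cat !invf_prods rev_cat prods_cat.
Qed.

Lemma exists_even_alcove i m : exists A, A i = m /\ odd_alcove A = false.
Proof.
have d := distinct3_shift i; have /and3P[ij jk ki] := d.
pose x (l : 'I_3) : int := if l == i then m else if l == i + 1 then - m else 0.
have sum_x : \sum_l x l = 0.
  rewrite (big_distinct3 _ _ d) /x !eqxx (negPf ki).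
  rewrite [i + 1 == i]eq_sym (negPf ij) [_ == i + 1]eq_sym (negPf jk) /=.
  by lia.
have x01 : \sum_l x l \in [:: 0; 1] by rewrite sum_x.
by exists (Alcove x01); rewrite /odd_alcove /= sum_x /x eqxx.
Qed.

Lemma reflectionP t : reflection P t <-> exists i m, t = aroot_refl i m.
Proof.
split=> [[w /WP[A ->] [n ->]]|[i [m ->]]].
  have [i lin_i] := linear_part_surj A n%:R; exists i; eexists.
  rewrite s_aroot_refl -lin_i weyl_elt_refl -compA.
  by rewrite (W_compV (W_weyl_elt _)).
have [A [Ai even_A]] := exists_even_alcove i m.
exists (weyl_elt A); first exact: W_weyl_elt.
exists (linear_part A i); rewrite s_aroot_refl natr_Zp weyl_elt_refl.
by rewrite even_A Ai addr0 -compA (W_compV (W_weyl_elt _)).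
Qed.

Lemma bruhat_step_weyl_elt A v : bruhat_step P (weyl_elt A) v <->
  exists2 B, alcove_step A B & v = weyl_elt B.
Proof.
split=> [[_ [t /reflectionP[j [m ->]] ->] len]|[B [[i [m ->]] len] ->]].
  have [i lin_i] := linear_part_surj A j; move: len.
  rewrite -lin_i weyl_elt_refl -weyl_elt_alcove_refl !ell_weyl_elt => len.
  by eexists => //; split=> //; eexists; eexists.
split; [exact: W_weyl_elt| |by rewrite !ell_weyl_elt].
have [m' refl_m'] := refl_weyl_elt A i m.
exists (aroot_refl (linear_part A i) m'); first by apply/reflectionP; eauto.
by rewrite weyl_elt_alcove_refl refl_m'.
Qed.

Lemma bruhat_weyl_elt_inv A v : bruhat P (weyl_elt A) v ->
  exists2 B, alcove_bruhat A B & v = weyl_elt B.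
Proof.
move eu : (weyl_elt A) => u uv.
elim: uv A eu => {u v} [u v uv|u|u v w _ IHuv _ IHvw] A eu.
- rewrite -eu in uv; have [B AB ->] := (bruhat_step_weyl_elt A v).1 uv.
  by exists B => //; apply: rt_step.
- by exists A; [apply: rt_refl |].
- have [B AB ev] := IHuv A eu; have [C BC ->] := IHvw B (esym ev).
  by exists C => //; apply: rt_trans BC.
Qed.

Theorem bruhat_weyl_elt A B : bruhat P (weyl_elt A) (weyl_elt B) <-> hexle A B.
Proof.
rewrite -alcove_bruhatP.
split=> [/bruhat_weyl_elt_inv[C AC /weyl_elt_inj->] //|].
elim=> {A B} [A B AB|A|A B C _ AB _ BC]; last exact: rt_trans BC.
  by apply/rt_step/bruhat_step_weyl_elt; exists B.
exact: rt_refl.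
Qed.

Lemma bruhat_W u v : W P u -> bruhat P u v -> W P v.
Proof. by move=> /WP[A ->] /bruhat_weyl_elt_inv[B _ ->]; apply: W_weyl_elt. Qed.

(** * Symmetries *)

Lemma diagram_isom_refl t i m :
  diagram_isom t \o aroot_refl (t i) m = aroot_refl i m \o diagram_isom t.
Proof.
have d := distinct3_shift i; have dt := d; rewrite -(distinct3_permute t) in dt.
apply/funext => v; apply: (aroot_inj2 d);
  by rewrite /= !(aroot_reflE d) !aroot_diagram_isom !(aroot_reflE dt).
Qed.

Lemma diagram_isom_weyl_elt t A :
  diagram_isom t \o weyl_elt A = weyl_elt (alcove_perm t A) \o diagram_isom t.
Proof.
have [L <- _] := reduced_word A; elim: L => [|i L IH].
  by rewrite alcove_perm0 weyl_elt0.
rewrite word_alcove_cons -[i%:R](permKV t) alcove_refl_perm.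
rewrite 2!weyl_elt_alcove_refl compA diagram_isom_refl.
by rewrite -[LHS]compA IH.
Qed.

Lemma invf_diagram_isom t : invf (diagram_isom t) = diagram_isom t^-1.
Proof. by apply: invf_can; [|rewrite -{2}[t]invgK]; apply: diagram_isomK. Qed.

Lemma conjf_weyl_elt t A :
  conjf (diagram_isom t) (weyl_elt A) = weyl_elt (alcove_perm t A).
Proof.
rewrite /conjf diagram_isom_weyl_elt -compA invf_diagram_isom.
by rewrite diagram_isomM mulgV diagram_isom1.
Qed.

Lemma isomsP g : isoms P g <-> exists t, g = diagram_isom t.
Proof.
split=> [|[t ->]].
  elim=> [|f h + _ [t ->]]; first by exists 1%g; rewrite diagram_isom1.
  by case=> ->; rewrite (deltaE, sigmaE) diagram_isomM; eexists.
have isom_shift c : isoms P (diagram_isom (shift3 c)).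
  rewrite -[c]natr_Zp -iter_delta; elim: (c : nat) => [|n IH].
    exact: generated_id.
  by apply: (@generated_comp _ _ (delta P) (iter n (delta P))) => //; left.
have [c [->|->]] := perm3_dihedral t; first exact: isom_shift.
rewrite -diagram_isomM -sigmaE.
by apply: generated_comp (isom_shift c); right.
Qed.

Lemma conjf_diagram_isomM t u :
  conjf (diagram_isom (t * u)) =
  conjf (diagram_isom t) \o conjf (diagram_isom u).
Proof.
apply/funext => w; rewrite /conjf /= !invf_diagram_isom invMg.
by rewrite -!diagram_isomM.
Qed.

Lemma isoms_G g : isoms P g -> G P (conjf g).
Proof.
elim=> [|f h Sf /isomsP[u ->] Gh].
  by rewrite conjf_id; apply: generated_id.
have [t ft] : exists t, f = diagram_isom t.
  by case: Sf => ->; rewrite (deltaE, sigmaE); eexists.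
rewrite ft diagram_isomM conjf_diagram_isomM -ft; apply: generated_comp => //.
by case: Sf => ->; [left; left | left; right].
Qed.

Lemma W_conjf t u : W P u -> W P (conjf (diagram_isom t) u).
Proof. by move=> /WP[A ->]; rewrite conjf_weyl_elt; apply: W_weyl_elt. Qed.

Lemma bruhat_conjf t u v : W P u -> bruhat P u v ->
  bruhat P (conjf (diagram_isom t) u) (conjf (diagram_isom t) v).
Proof.
move=> /WP[A ->] /[dup] /bruhat_weyl_elt_inv[B _ ->] /bruhat_weyl_elt AB.
by rewrite !conjf_weyl_elt; apply/bruhat_weyl_elt/hexle_perm.
Qed.

Lemma ell_invf u : W P u -> ell P (invf u) = ell P u.
Proof.
have ell_le w : W P w -> (ell P (invf w) <= ell P w)%N.
  move=> /WP[A ->]; have [L <- eL] := reduced_word A.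
  rewrite -prods_word invf_prods !prods_word !ell_weyl_elt -eL -(size_rev L).
  exact: alcove_length_word.
move=> Wu; apply/eqP; rewrite eqn_leq ell_le // -{1}(invf_invf Wu) ell_le //.
exact: W_invf.
Qed.

Lemma reflection_W t : reflection P t -> W P t.
Proof.
move=> [w Ww [i ->]]; apply: W_comp; last exact: W_invf.
by apply: W_comp => //; exists [:: i].
Qed.

Lemma bruhat_step_invf u v :
  W P v -> bruhat_step P u v -> bruhat_step P (invf u) (invf v).
Proof.
move=> Wv [Wu [t refl_t ev] len].
split; [exact: W_invf| |by rewrite !ell_invf].
have [i [m et]] := (reflectionP t).1 refl_t.
have tK : involutive t by rewrite et; apply: aroot_reflK.
have /WP[A eA] := W_invf Wu; have [m' refl_m'] := refl_weyl_elt A i m.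
exists (aroot_refl (linear_part A i) m'); first by apply/reflectionP; eauto.
rewrite ev (invf_comp Wu (reflection_W refl_t)) (invf_can tK tK).
by rewrite et eA refl_m'.
Qed.

Lemma bruhat_invf u v : W P u -> bruhat P u v -> bruhat P (invf u) (invf v).
Proof.
move=> + uv; elim: uv => {u v} [u v uv Wu|u _|u v w uv IHuv _ IHvw Wu].
- exact/rt_step/bruhat_step_invf/uv/(bruhat_W Wu)/rt_step.
- exact: rt_refl.
- exact: rt_trans (IHuv Wu) (IHvw (bruhat_W Wu uv)).
Qed.

Lemma G_bruhat g : G P g -> (forall u, W P u -> W P (g u)) /\
  (forall u v, W P u -> bruhat P u v -> bruhat P (g u) (g v)).
Proof.
elim=> [|f h Sf _ [Wh bruhat_h]]; first by split.
suff [Wf bruhat_f] : (forall u, W P u -> W P (f u)) /\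
    (forall u v, W P u -> bruhat P u v -> bruhat P (f u) (f v)).
  split=> [u Wu|u v Wu uv] /=; first exact/Wf/Wh.
  by apply/bruhat_f/bruhat_h/uv => //; apply: Wh.
case: Sf => [[|]|] ->; rewrite ?deltaE ?sigmaE.
- by split; [apply: W_conjf | apply: bruhat_conjf].
- by split; [apply: W_conjf | apply: bruhat_conjf].
- by split; [apply: W_invf | apply: bruhat_invf].
Qed.

(** * Dominant elements and strips *)

Lemma AplusP v : Aplus P v <-> forall i, -1 < aroot i v < 0.
Proof.
split=> [[v1 v2 vr]|v01]; first by elim/ord3_ind; rewrite /aroot //=; lra.
have := (v01 0, v01 1, v01 2).
by rewrite /aroot /= => -[[? ?] ?]; split; lra.
Qed.

Lemma aroot_cen_id i : aroot i (cen P id) = - 3^-1.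
Proof. by rewrite -weyl_elt0 aroot_cen odd_alcove0 addr0 mul1r sub0r. Qed.

Lemma cen_id_Aplus : Aplus P (cen P id).
Proof. by apply/AplusP => i; rewrite aroot_cen_id; lra. Qed.

Lemma aroot_weyl_elt_Aplus A v i :
  Aplus P v -> (A i)%:~R - 1 < aroot i (weyl_elt A v) < (A i)%:~R.
Proof.
move=> /AplusP/(_ (linear_part A i)); rewrite aroot_weyl_elt /weyl_elt_coord.
by case: odd_alcove; lra.
Qed.

Lemma D_weyl_elt A : D P (weyl_elt A) <-> dominant_at 0 A.
Proof.
split=> [[_ DA]|dA].
  have [pos1 pos2] : Cplus P (weyl_elt A (cen P id)).
    by apply: DA; exists (cen P id) => //; apply: cen_id_Aplus.
  have pos l : 0 < aroot l (weyl_elt A (cen P id)) -> 1 <= A l.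
    move=> l0; rewrite -gtz0_ge1 -(ltr0z R).
    by have := aroot_weyl_elt_Aplus A l cen_id_Aplus; lra.
  by elim/ord3_ind => // _; apply: pos.
split; first exact: W_weyl_elt.
move=> _ [v /aroot_weyl_elt_Aplus Av <-].
have pos l : l != 0 -> 0 < aroot l (weyl_elt A v).
  by move=> /dA; rewrite -(ler1z R); have := Av A l; lra.
by split; [apply: (pos 1) | apply: (pos 2)].
Qed.

Lemma s_weyl_elt i A : s P i \o weyl_elt A = weyl_elt (alcove_refl i%:R 0 A).
Proof. by rewrite weyl_elt_alcove_refl s_aroot_refl. Qed.

Lemma s0D_weyl_elt A : s0D P (weyl_elt A) <-> antidominant_at 0 A.
Proof.
split=> [[w /[dup] [[/WP[B ->] _]] /D_weyl_elt dB]|aA].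
  rewrite s_weyl_elt => /weyl_elt_inj<-.
  by apply/dominant_at_refl; rewrite alcove_reflK.
exists (weyl_elt (alcove_refl 0 0 A)).
  exact/D_weyl_elt/dominant_at_refl.
by rewrite s_weyl_elt alcove_reflK.
Qed.

Lemma iter_conjf_delta n :
  iter n (conjf (delta P)) = conjf (diagram_isom (shift3 n%:R)).
Proof.
elim: n => [|n IH]; apply/funext => w; first by rewrite -iter_delta conjf_id.
by rewrite iterS IH deltaE -natr1 addrC -shift3D conjf_diagram_isomM.
Qed.

Lemma iter_conjf_deltaP (S : set (E -> E)) n B : S `<=` W P ->
  [set iter n (conjf (delta P)) w | w in S] (weyl_elt B) <->
  S (weyl_elt (alcove_perm (shift3 n%:R)^-1 B)).
Proof.
move=> SW; rewrite iter_conjf_delta.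
split=> [[w /[dup] /SW /WP[A ->] SA]|SB].
  rewrite conjf_weyl_elt => /weyl_elt_inj <-.
  by rewrite alcove_permM mulVg alcove_perm1.
eexists; first exact: SB.
by rewrite conjf_weyl_elt alcove_permM mulgV alcove_perm1.
Qed.

Lemma iter_conjf_delta_D n B :
  [set iter n (conjf (delta P)) w | w in D P] (weyl_elt B) <->
  dominant_at n%:R B.
Proof.
rewrite iter_conjf_deltaP; last by move=> w [].
by rewrite D_weyl_elt dominant_at_perm shift3VE add0r.
Qed.

Lemma iter_conjf_delta_s0D n B :
  [set iter n (conjf (delta P)) w | w in s0D P] (weyl_elt B) <->
  antidominant_at n%:R B.
Proof.
rewrite iter_conjf_deltaP; last first.
  by move=> _ [w [Ww _] <-]; apply: W_comp => //; exists [:: 0%N].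
by rewrite s0D_weyl_elt antidominant_at_perm shift3VE add0r.
Qed.

Definition xk_alcove k : alcove := word_alcove (iota 1 k).

Lemma xk_weyl_elt k : xk P k = weyl_elt (xk_alcove k).
Proof. exact: prods_word. Qed.

Lemma word_alcove_succ L :
  word_alcove (map S L) = alcove_perm (shift3 1) (word_alcove L).
Proof.
elim: L => [|i L IH]; first by rewrite alcove_perm0.
rewrite map_cons !word_alcove_cons IH -alcove_refl_perm.
by rewrite permE -natr1 addrK.
Qed.

Lemma xk_alcoveE k : (xk_alcove k 0 = - (k./2)%:Z) *
  (xk_alcove k 1 = (uphalf k)%:Z) * (xk_alcove k 2 = 0).
Proof.
elim: k => [|k IH] //.
have -> : xk_alcove k.+1 =
    alcove_refl 1 0 (alcove_perm (shift3 1) (xk_alcove k)).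
  by rewrite -word_alcove_succ -(iotaDl 1 1 k).
have [t0 t1 t2] : [/\ shift3 1 0 = 2, shift3 1 1 = 0 & shift3 1 2 = 1].
  by split; rewrite permE; apply/val_inj.
rewrite !(@alcove_reflE 1 2 0 isT) !alcove_permE t0 t1 t2 !IH.
by split; [split|]; lia.
Qed.

Lemma alcove_perm_xkP (t : 'S_3) i j k A : distinct3 i j k ->
  t i = 1 -> t j = 2 -> t k = 0 ->
  [/\ 0 <= A i, A j = 0 & A k <= 0] <->
  exists2 n, A = alcove_perm t (xk_alcove n) & A i = uphalf n.
Proof.
move=> d ti tj tk; split=> [[Ai Aj Ak]|[n eA Ain]]; last first.
  by rewrite eA !alcove_permE ti tj tk !xk_alcoveE; split; lia.
have sA := sum_coord A d; exists (`|A i| + `|A k|)%N; last first.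
  by case: odd_alcove sA; lia.
apply: (alcove_eq3 d); rewrite alcove_permE ?ti ?tj ?tk xk_alcoveE //;
  by case: odd_alcove sA; lia.
Qed.

Lemma strip_weyl_elt A :
  strip P (weyl_elt A) <-> [/\ 1 <= A 0, A 1 = 0 & A 2 <= 0].
Proof.
have d : distinct3 0 1 2 by []; set t := (shift3 1%R)^-1%g.
have [t0 t1 t2] : [/\ t 0 = 1, t 1 = 2 & t 2 = 0].
  by split; rewrite /t shift3VE; apply/val_inj.
have deltaV : invf (delta P) = diagram_isom t.
  by rewrite deltaE invf_diagram_isom.
split=> [[n n1]|[A0 A1 A2]].
  rewrite deltaV xk_weyl_elt conjf_weyl_elt => /weyl_elt_inj->.
  by rewrite !alcove_permE t0 t1 t2 !xk_alcoveE; split; lia.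
have [|n eA eA0] := (alcove_perm_xkP A d t0 t1 t2).1; first by split; lia.
by exists n; [lia | rewrite deltaV xk_weyl_elt conjf_weyl_elt -eA].
Qed.

(** * Polygons *)

Lemma convex_line (K : set E) p q v i j k : distinct3 i j k ->
  @convex_set R E K -> K p -> K q ->
  aroot i p - aroot j p = aroot i v - aroot j v ->
  aroot i q - aroot j q = aroot i v - aroot j v ->
  aroot k p <= aroot k v <= aroot k q -> K v.
Proof.
move=> d /convex_setP cK Kp Kq pv qv /andP[pk kq].
have [sp [sq sv]] := (sum_aroot3 p d, (sum_aroot3 q d, sum_aroot3 v d)).
have [e|ne] := eqVneq (aroot k p) (aroot k q).
  by have -> : v = p by apply: (aroot_inj2 d); lra.
have pq : 0 < aroot k q - aroot k p.
  by rewrite subr_gt0 lt_neqAle ne (le_trans pk).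
pose t := (aroot k q - aroot k v) / (aroot k q - aroot k p).
have tE : t * (aroot k q - aroot k p) = aroot k q - aroot k v.
  by rewrite divfK ?gt_eqF.
have -> : v = t *: p + (1 - t) *: q.
  apply: (aroot_inj2 d); rewrite aroot_comb.
    have -> : aroot i p = aroot i q + (aroot k q - aroot k p) / 2 by lra.
    by lra.
  have -> : aroot j p = aroot j q + (aroot k q - aroot k p) / 2 by lra.
  by lra.
by apply: cK => //; rewrite divr_ge0 ?ler_pdivrMr //=; lra.
Qed.

Lemma exists_aroot_diffs i j k x y : distinct3 i j k ->
  exists p, aroot i p - aroot j p = x /\ aroot k p - aroot i p = y.
Proof.
move=> d; have [ij jk ki] := and3P d; pose c := (x - y - 1) / 3.
pose f l := c + (if l == i then 0 else if l == j then - x else y).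
have [fi fj fk] : [/\ f i = c, f j = c - x & f k = c + y].
  rewrite /f !eqxx [j == i]eq_sym (negPf ij) (negPf ki) [k == j]eq_sym.
  by rewrite (negPf jk) addr0.
have sum_f : \sum_l f l = -1.
  by rewrite (big_distinct3 _ _ d) /= fi fj fk /c; field.
by exists (point f); rewrite !aroot_point // fi fj fk; split; ring.
Qed.

(* Consecutive sides of the hexagon bound differences with the same first or
   the same last index, so the corners are the points attaining, for some l,
   both bounds of the form [m l _] or both bounds of the form [m _ l]. *)
Section ConvexHexagon.
Variables (K : set E) (m : 'I_3 -> 'I_3 -> R).
Hypothesis convexK : @convex_set R E K.
Hypothesis sourceK :
  forall i, exists2 p, K p & forall j, i != j -> aroot i p - aroot j p = m i j.
Hypothesis sinkK :
  forall j, exists2 p, K p & forall i, i != j -> aroot i p - aroot j p = m i j.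

Lemma convex_hexagon_edge v i j k : distinct3 i j k ->
  aroot i v - aroot k v = m i k -> aroot i v - aroot j v <= m i j ->
  aroot j v - aroot k v <= m j k -> K v.
Proof.
move=> d vik vij vjk; have [ij jk ki] := and3P d.
have ik : i != k by rewrite eq_sym.
have [p Kp pi] := sourceK i; have [q Kq qk] := sinkK k.
have [sp [sq sv]] := (sum_aroot3 p d, (sum_aroot3 q d, sum_aroot3 v d)).
have := (pi j ij, pi k ik, qk i ik, qk j jk) => -[[[? ?] ?] ?].
by apply: (convex_line (distinct3_flip d) convexK Kp Kq); lra.
Qed.

Variable v : E.
Hypothesis v_le : forall i j, i != j -> aroot i v - aroot j v <= m i j.

Lemma convex_hexagon_above i j k : distinct3 i j k ->
  exists p, [/\ K p, aroot i p - aroot j p = aroot i v - aroot j v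
    & aroot k v <= aroot k p].
Proof.
wlog le_kj : i j / m k i + (aroot i v - aroot j v) <= m k j => [wlog_le|] d.
  have [/wlog_le/(_ d)//|lt] := leP (m k i + (aroot i v - aroot j v)) (m k j).
  have [||p [Kp ? ?]] := wlog_le j i; first by lra.
    exact: distinct3_flip (distinct3_rot d).
  by exists p; split=> //; lra.
have [ij jk ki] := and3P d; have ji : j != i by rewrite eq_sym.
have [p [pij pki]] := exists_aroot_diffs (aroot i v - aroot j v) (m k i) d.
have [vji vki] := (v_le ji, v_le ki).
have [sv sp] := (sum_aroot3 v d, sum_aroot3 p d).
exists p; split=> //; last lra.
by apply: (convex_hexagon_edge (distinct3_rot (distinct3_flip d))); lra.
Qed.

Lemma convex_hexagon_below i j k : distinct3 i j k ->
  exists p, [/\ K p, aroot i p - aroot j p = aroot i v - aroot j v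
    & aroot k p <= aroot k v].
Proof.
wlog le_jk : i j / m i k <= m j k + (aroot i v - aroot j v) => [wlog_le|] d.
  have [/wlog_le/(_ d)//|lt] := leP (m i k) (m j k + (aroot i v - aroot j v)).
  have [||p [Kp ? ?]] := wlog_le j i; first by lra.
    exact: distinct3_flip (distinct3_rot d).
  by exists p; split=> //; lra.
have [ij jk ki] := and3P d; have ik : i != k by rewrite eq_sym.
have [p [pij pki]] := exists_aroot_diffs (aroot i v - aroot j v) (- m i k) d.
have [vij vik] := (v_le ij, v_le ik).
have [sv sp] := (sum_aroot3 v d, sum_aroot3 p d).
exists p; split=> //; last lra.
by apply: (convex_hexagon_edge d); lra.
Qed.

Lemma convex_hexagon : K v.
Proof.
have d : distinct3 0 1 2 by [].
have [p [Kp vp ?]] := convex_hexagon_above d.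
have [q [Kq vq ?]] := convex_hexagon_below d.
by apply: (convex_line d convexK Kq Kp) => //; apply/andP.
Qed.

End ConvexHexagon.

Definition hexagon B : set E := [set v | forall i j k, distinct3 i j k ->
  aroot i v - aroot j v <= (hexbound B i j k)%:~R].

Lemma cen_hexagon A B : hexagon B (cen P (weyl_elt A)) <-> hexle A B.
Proof. by split=> AB i j k /AB; rewrite aroot_cenB ler_int. Qed.

Lemma hexagon_convex B : @convex_set R E (hexagon B).
Proof.
apply/convex_setP => p q t /andP[t0 t1] Bp Bq i j k d.
by have [pij qij] := (Bp _ _ _ d, Bq _ _ _ d); rewrite !aroot_comb; nra.
Qed.

Lemma hull_sub_hexagon (S : set E) B :
  (forall p, S p -> exists2 A, p = cen P (weyl_elt A) & hexle A B) ->
  convex_hull S `<=` hexagon B.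
Proof.
move=> SB; apply: smallest_sub; first exact: hexagon_convex.
by move=> _ /SB[A ->] AB; apply/cen_hexagon.
Qed.

Lemma hexagon_sub_hull (S : set E) B :
  contains_corners [set A | S (cen P (weyl_elt A))] B ->
  hexagon B `<=` convex_hull S.
Proof.
move=> corners v Bv; pose m i j : R := (hexbound B i j (- (i + j)))%:~R.
have sub_hull : S `<=` convex_hull S by apply: sub_gen_smallest.
apply: (@convex_hexagon _ m) => [|i|j|i j ij].
- exact: convex_convex_hull.
- have [[A SA Ai] _] := corners i; exists (cen P (weyl_elt A)) => [|j ij].
    exact: sub_hull.
  by rewrite aroot_cenB (Ai _ _ (distinct3_third ij)).
- have [_ [A SA Aj]] := corners j; exists (cen P (weyl_elt A)) => [|i ij].
    exact: sub_hull.
  by rewrite aroot_cenB (Aj _ _ (distinct3_third ij)).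
- exact: Bv (distinct3_third ij).
Qed.

Lemma hexagon_alcove0 : hexagon alcove0 = [set cen P id].
Proof.
apply/seteqP; split=> [v v0|_ ->]; last first.
  by rewrite -weyl_elt0; apply/cen_hexagon/hexlexx.
apply: aroot_inj => i; rewrite aroot_cen_id.
have le j k l (d : distinct3 j k l) : aroot j v <= aroot k v.
  by have := v0 _ _ _ d; rewrite /hexbound !alcove0E; lra.
have d := distinct3_shift i; have dj := distinct3_rot d.
have [ij ki] := (le _ _ _ d, le _ _ _ (distinct3_rot dj)).
have [ik ji] := (le _ _ _ (distinct3_flip d), le _ _ _ (distinct3_flip dj)).
by have := sum_aroot3 v d; lra.
Qed.

Lemma s_alcove i : s P i = weyl_elt (alcove_refl i%:R 0 alcove0).
Proof. by rewrite weyl_elt_alcove_refl weyl_elt0 s_aroot_refl. Qed.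

Lemma hull_simple i : convex_hull [set cen P id; cen P (s P i)] =
  hexagon (alcove_refl i%:R 0 alcove0).
Proof.
rewrite s_alcove -weyl_elt0; apply/seteqP; split.
  apply: hull_sub_hexagon => _ [] ->; eexists => //; first exact: hexle0x.
  exact: hexlexx.
by apply: hexagon_sub_hull; apply: simple_corners; [left | right].
Qed.

Let residues : seq nat -> seq 'I_3 := map (fun n => n%:R).

Lemma hull_dominant i B : dominant_at i%:R B ->
  convex_hull [set cen P (w \o weyl_elt B) | w in parabolic P i.+1 i.+2] =
  hexagon B.
Proof.
move=> dB; have d := distinct3_natr i; apply/seteqP; split.
  apply: hull_sub_hexagon => _ [_ [L sL ->] <-]; rewrite prods_weyl_elt.
  eexists => //; apply: hexle_act_word => _ /mapP[n Ln ->].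
  have := (forall_neq_distinct3 _ d).1 dB.
  by have := sL n Ln; rewrite !inE => /orP[] /eqP-> [].
apply: hexagon_sub_hull; apply: (dominant_corners d dB) => M.
move=> /(mapP (f := residues) (s := dominant_words i.+1 i.+2))[L L_in ->].
exists (prods P L); last by rewrite prods_weyl_elt.
exists L => //; apply/allP; move: L_in; rewrite !inE.
by do 5?[case/orP]; move=> /eqP->; rewrite /= ?inE ?eqxx ?orbT.
Qed.

Lemma hull_antidominant i B : antidominant_at i%:R B ->
  convex_hull [set cen P (prods P L \o weyl_elt B)
    | L in [set` antidominant_words i i.+1 i.+2]] = hexagon B.
Proof.
move=> aB; have d := distinct3_natr i; apply/seteqP; split.
  apply: hull_sub_hexagon => _ [L L_in <-]; rewrite prods_weyl_elt.
  eexists => //; apply: (hexle_antidominant_words d aB).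
  exact: map_f L_in.
apply: hexagon_sub_hull; apply: (antidominant_corners d aB) => M.
move=> /(mapP (f := residues) (s := antidominant_words i i.+1 i.+2))[L L_in ->].
by exists L; rewrite // prods_weyl_elt.
Qed.

Lemma hull_xk_sub_hexagon g k B : G P g -> (2 <= k)%N ->
  weyl_elt B = g (xk P k) ->
  convex_hull [set cen P (g (prods P L \o xk P k))
    | L in [set` strip_words 1%N 2%N]] `<=` hexagon B.
Proof.
move=> Gg k2 eB; have [Wg bruhat_g] := G_bruhat Gg.
apply: hull_sub_hexagon => _ [L L_in <-].
rewrite xk_weyl_elt prods_weyl_elt.
have Wx := W_weyl_elt (act_word [seq n%:R | n <- L] (xk_alcove k)).
have /WP[A gA] := Wg _ Wx; exists A; first by rewrite gA.
apply/bruhat_weyl_elt; rewrite -gA eB xk_weyl_elt; apply: bruhat_g => //.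
apply/bruhat_weyl_elt/(@hexle_strip_words 1 2 0) => //.
- by rewrite xk_alcoveE; lia.
- by rewrite xk_alcoveE; lia.
- exact: map_f L_in.
Qed.

Lemma hexagon_sub_hull_xk i j k B : distinct3 i j k ->
  1 <= B i -> B j = 0 -> B k <= -1 ->
  exists g n, [/\ G P g, (2 <= n)%N, weyl_elt B = g (xk P n)
    & hexagon B `<=` convex_hull [set cen P (g (prods P L \o xk P n))
        | L in [set` strip_words 1%N 2%N]]].
Proof.
move=> d Bi Bj Bk; have dk := distinct3_rot (distinct3_rot d).
have [u [u0 u1 u2]] := distinct3_perm dk; pose t := u^-1%g.
have [ti tj tk] : [/\ t i = 1, t j = 2 & t k = 0].
  by rewrite /t -u0 -u1 -u2 !permK.
have [|n eB Bin] := (alcove_perm_xkP B d ti tj tk).1; first by split; lia.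
have gE L : weyl_elt (act_word L B) =
    conjf (diagram_isom t) (prods P [seq t l : nat | l <- L] \o xk P n).
  rewrite xk_weyl_elt prods_weyl_elt conjf_weyl_elt eB -act_word_perm -map_comp.
  congr (weyl_elt (alcove_perm _ (act_word _ _))).
  by apply: eq_map => l; rewrite /= natr_Zp.
exists (conjf (diagram_isom t)), n; split.
- by apply/isoms_G/isomsP; exists t.
- by move: Bin Bk; rewrite eB !alcove_permE tk xk_alcoveE; lia.
- by rewrite -[B in LHS]/(act_word [::] B) gE.
apply: hexagon_sub_hull; apply: (strip_corners d Bi Bj Bk) => L L_in.
exists [seq t l : nat | l <- L]; last by rewrite -gE.
by have := map_f (map (fun l => t l : nat)) L_in; rewrite /= ti tj.
Qed.

Lemma polygon_sub_hexagon B : polygon P (weyl_elt B) `<=` hexagon B.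
Proof.
move=> v; move ey : (weyl_elt B) => y yv.
case: yv ey => [{}v -> ->|i {}v -> +|i {}v _ + +|i {}v _ + +|g k {}v Gg k2 ->].
- by rewrite -{1}weyl_elt0 => /weyl_elt_inj->; rewrite hexagon_alcove0.
- by rewrite s_alcove => vi /weyl_elt_inj->; rewrite -hull_simple s_alcove.
- by move=> + + ey; rewrite -ey => /iter_conjf_delta_D/hull_dominant->.
- move=> + + ey; rewrite -ey => /iter_conjf_delta_s0D/hull_antidominant<-.
  by rewrite image_antidominant_words.
- move=> + eB; pose f L := cen P (g (prods P L \o xk P k)).
  by rewrite -(image_strip_words f); apply: hull_xk_sub_hexagon.
Qed.

Lemma hexagon_sub_polygon B : hexagon B `<=` polygon P (weyl_elt B).
Proof.
move=> v; have [->|i ->|i|i|i j k d Bi Bj Bk] := alcove_case B.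
- by rewrite hexagon_alcove0 weyl_elt0 => ->; apply: polygon_id.
- rewrite -[i]natr_Zp -s_alcove -hull_simple => vi.
  exact: polygon_s vi.
- rewrite -[i]natr_Zp => dB; rewrite -(hull_dominant dB) => vB.
  by apply: polygon_D (ltn_ord i) _ vB; apply/iter_conjf_delta_D.
- rewrite -[i]natr_Zp => aB; rewrite -(hull_antidominant aB).
  rewrite image_antidominant_words => vB.
  by apply: polygon_s0D (ltn_ord i) _ vB; apply/iter_conjf_delta_s0D.
- have [g [n [Gg n2 -> sub]]] := hexagon_sub_hull_xk d Bi Bj Bk.
  by move=> /sub; rewrite image_strip_words; apply: polygon_xk.
Qed.

Theorem polygon_weyl_elt B : polygon P (weyl_elt B) = hexagon B.
Proof.
apply/seteqP; split; [exact: polygon_sub_hexagon|exact: hexagon_sub_polygon].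
Qed.

(** * Stars *)

Definition triangle i j k (a b c : R) : set E := [set v |
  [/\ aroot i v - aroot j v <= a, aroot j v - aroot k v <= b
    & aroot k v - aroot i v <= c]].

Definition open_triangle i j k (a b c : R) : set E := [set v |
  [/\ aroot i v - aroot j v < a, aroot j v - aroot k v < b
    & aroot k v - aroot i v < c]].

Lemma triangle_rot i j k a b c : triangle i j k a b c = triangle j k i b c a.
Proof. by apply/seteqP; split=> v [? ? ?]; split. Qed.

Lemma open_triangle_rot i j k a b c :
  open_triangle i j k a b c = open_triangle j k i b c a.
Proof. by apply/seteqP; split=> v [? ? ?]; split. Qed.

Lemma not_open_triangle i j k a b c v : ~ open_triangle i j k a b c v ->
  [\/ a <= aroot i v - aroot j v, b <= aroot j v - aroot k v
    | c <= aroot k v - aroot i v].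
Proof.
rewrite !leNgt => /not_and3P[] /negP.
- exact: Or31.
- exact: Or32.
- exact: Or33.
Qed.

Lemma aroot_continuous i : continuous (aroot i).
Proof.
rewrite /aroot; case: (i : nat) => [|[|?]]; try exact: dot_continuous.
move=> v; apply: (@cvgB _ _ _ (nbhs v)); last exact: cvg_cst.
by apply: (@cvgN _ _ _ (nbhs v)); apply: dot_continuous.
Qed.

Lemma open_open_triangle i j k a b c : open (open_triangle i j k a b c).
Proof.
have halfplane p q m : open [set v | aroot p v - aroot q v < m].
  pose f v := aroot p v - aroot q v.
  apply: (@open_comp _ _ f [set x | x < m]); last exact: open_lt.
  by move=> v _; apply: (@cvgB _ _ _ (nbhs v)); apply: aroot_continuous.
have -> : open_triangle i j k a b c = [set v | aroot i v - aroot j v < a] `&`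
    [set v | aroot j v - aroot k v < b] `&` [set v | aroot k v - aroot i v < c].
  by apply/seteqP; split=> v [] => [? ? ?|[? ?] ?].
by do 2?apply: openI.
Qed.

Lemma interior_aroot_translate (K : set E) v i j k (r : R) :
  distinct3 i j k -> interior K v ->
  exists t w, [/\ 0 < t, K w,
    aroot i w - aroot j w = aroot i v - aroot j v + r * t,
    aroot i w - aroot k w = aroot i v - aroot k v + r * t
    & aroot j w - aroot k w = aroot j v - aroot k v].
Proof.
move=> d Kv; pose x l : R := if l == i then 2 * r / 3 else - r / 3.
have [xi xj xk] : [/\ x i = 2 * r / 3, x j = - r / 3 & x k = - r / 3].
  have [ij jk ki] := and3P d.
  by rewrite /x eqxx [j == i]eq_sym (negPf ij) (negPf ki).
have sum_x : \sum_l x l = 0.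
  by rewrite (big_distinct3 _ _ d) /= xi xj xk; field.
have [t t0 Kt] := interior_translate (point x) Kv.
exists t, (v + t *: point x); rewrite !aroot_translate // xi xj xk.
by split=> //; field.
Qed.

(* Unless two boundary normals, one of each triangle, are opposite, some
   direction leaves both triangles at once. *)
Lemma interior_triangleU i j k a b c a' b' c' : distinct3 i j k ->
  0 < a + a' -> 0 < b + b' -> 0 < c + c' ->
  interior (triangle i j k a b c `|` triangle j i k a' c' b') =
  open_triangle i j k a b c `|` open_triangle j i k a' c' b'.
Proof.
move=> d aa bb cc; apply/seteqP; split=> v; last first.
  have sub : open_triangle i j k a b c `|` open_triangle j i k a' c' b'
      `<=` triangle i j k a b c `|` triangle j i k a' c' b'.
    by move=> w [] [? ? ?]; [left | right]; split; apply: ltW.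
  move: sub; rewrite open_subsetE; first exact.
  by apply: openU; apply: open_open_triangle.
move=> Uv; apply: contrapT => /not_orP[/not_open_triangle + /not_open_triangle].
have push p q r m dpqr := @interior_aroot_translate _ v p q r m dpqr Uv.
have [dj dk] := (distinct3_rot d, distinct3_rot (distinct3_rot d)).
case=> le_v; case=> le_v'; try lra.
- by have [t [w [t0 [] [? ? ?] ? ? ?]]] := push _ _ _ 1 d; lra.
- by have [t [w [t0 [] [? ? ?] ? ? ?]]] := push _ _ _ (-1) dj; lra.
- by have [t [w [t0 [] [? ? ?] ? ? ?]]] := push _ _ _ 1 dj; lra.
- by have [t [w [t0 [] [? ? ?] ? ? ?]]] := push _ _ _ (-1) dk; lra.
- by have [t [w [t0 [] [? ? ?] ? ? ?]]] := push _ _ _ (-1) d; lra.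
- by have [t [w [t0 [] [? ? ?] ? ? ?]]] := push _ _ _ 1 dk; lra.
Qed.

Definition star_triangle X i j k : set E :=
  let m := X i - X j in triangle i j k m%:~R (m + 1)%:~R (m + 2)%:~R.

Definition open_star_triangle X i j k : set E :=
  let m := X i - X j in open_triangle i j k m%:~R (m + 1)%:~R (m + 2)%:~R.

Lemma open_star_triangle_cen X i j k Z :
  open_star_triangle X i j k (cen P (weyl_elt Z)) <->
  hexbound Z i j k < X i - X j.
Proof.
rewrite /open_star_triangle /open_triangle /hexbound /= !aroot_cenB !ltr_int.
rewrite !gt_max.
by split=> [[? ? ?]|/and3P[? ? ?]]; [apply/and3P|]; split; lia.
Qed.

Lemma star_triangle_diagram_isom t X i j k v :
  star_triangle (alcove_perm t X) i j k (diagram_isom t v) <->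
  star_triangle X (t i) (t j) (t k) v.
Proof. by rewrite /star_triangle /triangle /= !aroot_diagram_isom. Qed.

Definition vertex (i : 'I_3) : E := point (fun l => - (l == i)%:R).

Lemma aroot_vertex i l : aroot l (vertex i) = - (l == i)%:R.
Proof.
rewrite aroot_point // sumrN (bigD1 i) //= eqxx big1 ?addr0 // => j.
by move=> /negPf->.
Qed.

Lemma vertexE :
  (vertex 0 = 0) * (vertex 1 = - varpi1 P) * (vertex 2 = - varpi2 P).
Proof.
by rewrite /vertex /point /= !(oppr0, scaleN1r, scale0r, add0r, addr0).
Qed.

Definition gauge i j k (c v : E) : R :=
  Num.max (aroot i v - aroot j v - (aroot i c - aroot j c))
    (Num.max (aroot j v - aroot k v - (aroot j c - aroot k c))
             (aroot k v - aroot i v - (aroot k c - aroot i c))).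

Lemma gauge_rot i j k c v : gauge i j k c v = gauge j k i c v.
Proof. by rewrite /gauge maxC -maxA. Qed.

Lemma M_gauge c v : (M1 P (v - c) = gauge 1 0 2 c v / 3) *
  (M2 P (v - c) = gauge 2 0 1 c v / 3).
Proof.
have dot_varpi1B : dot (varpi1 P) (v - c) =
    (aroot 1 v - aroot 0 v - (aroot 1 c - aroot 0 c)) / 3.
  rewrite varpi1E dotBr /aroot /= !dotDl !(dotC (_ *: _)) !dotZr.
  by rewrite !(dotC v) !(dotC c); field.
have dot_varpi2B : dot (varpi2 P) (v - c) =
    (aroot 2 v - aroot 0 v - (aroot 2 c - aroot 0 c)) / 3.
  rewrite varpi2E dotBr /aroot /= !dotDl !(dotC (_ *: _)) !dotZr.
  by rewrite !(dotC v) !(dotC c); field.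
rewrite /M1 /M2 /gauge !maxr_pMl // !dotDl !dotNl dot_varpi1B dot_varpi2B.
by split; congr (Num.max _ (Num.max _ _)); field.
Qed.

Lemma gauge_star_triangle X i j k v : distinct3 i j k ->
  X j - X k <= X i - X j + 1 -> X k - X i <= X i - X j + 2 ->
  gauge i j k (vertex i) v <= gauge i j k (vertex i) (cen P (weyl_elt X)) <->
  star_triangle X i j k v.
Proof.
move=> d Xjk Xki; have [ij jk ki] := and3P d.
have eq_i : (i == i = true) * (j == i = false) * (k == i = false).
  by rewrite eqxx eq_sym (negPf ij) (negPf ki).
have gauge_cen : gauge i j k (vertex i) (cen P (weyl_elt X)) =
    (X i - X j + 1)%:~R.
  rewrite /gauge !aroot_vertex !aroot_cenB !eq_i max_l.
    by rewrite intrD /=; ring.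
  by rewrite ge_max; move: Xjk Xki; rewrite -!(ler_int R) !intrD /=; lra.
rewrite gauge_cen /gauge !aroot_vertex !eq_i !ge_max.
rewrite /star_triangle /triangle /= !intrD.
by split=> [/and3P[? ? ?]|[? ? ?]]; [|apply/and3P]; split; lra.
Qed.

Lemma triangles_dominant X (p := cen P (weyl_elt X)) : dominant_at 0 X ->
  triangle_l P (- varpi1 P) p `|` triangle_r P (- varpi2 P) p =
  star_triangle X 1 0 2 `|` star_triangle X 2 0 1.
Proof.
have d : distinct3 0 1 2 by []; move=> /(forall_neq_distinct3 _ d)[X1 X2].
have sX := sum_coord X d; rewrite -!vertexE.
congr (_ `|` _); apply/seteqP; split=> v; rewrite /triangle_l /triangle_r /=;
  rewrite !M_gauge ler_pM2r // gauge_star_triangle //;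
  by case: odd_alcove sX; lia.
Qed.

Lemma triangles_opposite X (p := cen P (weyl_elt X)) : opposite_at 0 X ->
  triangle_l P 0 p `|` triangle_r P 0 p =
  star_triangle X 0 2 1 `|` star_triangle X 0 1 2.
Proof.
have d : distinct3 0 1 2 by []; move=> /(forall_neq_distinct3 _ d)[X1 X2].
have sX := sum_coord X d; rewrite -vertexE.
congr (_ `|` _); apply/seteqP; split=> v; rewrite /triangle_l /triangle_r /=;
  rewrite !M_gauge ler_pM2r // !(gauge_rot 1, gauge_rot 2);
  by rewrite gauge_star_triangle //; case: odd_alcove sX; lia.
Qed.

Definition star_part i j k X (v : E) : Prop :=
  (dominant_at i X /\ star_triangle X j i k v) \/
  (opposite_at i X /\ star_triangle X i j k v).

Lemma star_part_perm t i j k X v :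
  star_part i j k (alcove_perm t X) (diagram_isom t v) <->
  star_part (t i) (t j) (t k) X v.
Proof.
rewrite /star_part dominant_at_perm opposite_at_perm.
by rewrite !star_triangle_diagram_isom.
Qed.

Lemma s0D_strip_opposite X :
  (s0D P `|` strip P) (weyl_elt X) -> opposite_at 0 X.
Proof.
have d : distinct3 0 1 2 by [].
move=> sX; apply/(forall_neq_distinct3 _ d).
by case: sX => [/s0D_weyl_elt/(forall_neq_distinct3 _ d)|/strip_weyl_elt];
  case; lia.
Qed.

Lemma opposite_s0D_strip X : opposite_at 0 X -> X <> alcove0 ->
  X 1 = 0 \/ X 2 <> 0 -> (s0D P `|` strip P) (weyl_elt X).
Proof.
have d : distinct3 0 1 2 by []; move=> oX X0 X12.
have [X1 X2] := (forall_neq_distinct3 _ d).1 oX.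
have [X1_0|X1_n0] := eqVneq (X 1) 0.
  by right; apply/strip_weyl_elt; split=> //; apply: opposite_at_gt0.
by left; apply/s0D_weyl_elt/(forall_neq_distinct3 _ d); case: X12; lia.
Qed.

Lemma star0_sub X v : star0 P (weyl_elt X) v ->
  star_part 0 1 2 X v \/ star_part 0 2 1 X v.
Proof.
case=> {}v; first move=> /D_weyl_elt dX; rewrite ?triangles_dominant //.
  by case; [left | right]; left.
move=> /s0D_strip_opposite oX; rewrite triangles_opposite //.
by case; [right | left]; right.
Qed.

(* [strip] contains only one of the two families of strips exchanged by sigma,
   whence the condition on X. *)
Lemma star0_sup X v : X <> alcove0 -> X 1 = 0 \/ X 2 <> 0 ->
  star_part 0 1 2 X v \/ star_part 0 2 1 X v -> star0 P (weyl_elt X) v.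
Proof.
move=> X0 X12 Xv.
have [[dX tv]|[oX tv]] :
  (dominant_at 0 X /\ (star_triangle X 1 0 2 `|` star_triangle X 2 0 1) v) \/
  (opposite_at 0 X /\ (star_triangle X 0 2 1 `|` star_triangle X 0 1 2) v).
- by case: Xv => -[] [? ?]; [left|right|left|right]; split=> //;
    by [left | right].
- by apply: star0_D; rewrite ?triangles_dominant //; apply/D_weyl_elt.
- apply: star0_s0D; rewrite ?triangles_opposite //.
  exact: opposite_s0D_strip.
Qed.

Lemma starP X v : star P (weyl_elt X) v <->
  exists t, star0 P (weyl_elt (alcove_perm t X)) (diagram_isom t v).
Proof.
split=> [[_ /isomsP[t ->]] /=|[t Xv]].
  by rewrite conjf_weyl_elt; exists t.
exists (diagram_isom t); first by apply/isomsP; exists t.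
by rewrite /= conjf_weyl_elt.
Qed.

Lemma star_weyl_elt X v : X <> alcove0 -> star P (weyl_elt X) v <->
  exists i j k, distinct3 i j k /\ star_part i j k X v.
Proof.
move=> X0; have d : distinct3 0 1 2 by [].
rewrite starP; split=> [[t /star0_sub[] /star_part_perm]|].
- by exists (t 0), (t 1), (t 2); rewrite distinct3_permute.
- by exists (t 0), (t 2), (t 1); rewrite distinct3_permute.
move=> [i [j [k [dijk Xv]]]].
have perm_X0 t : alcove_perm t X <> alcove0.
  by rewrite -(alcove_perm0 t) => /alcove_perm_inj.
have [Xjk|/not_orP[Xj /contrapT Xk]] := pselect (X j = 0 \/ X k <> 0).
  have [t [t0 t1 t2]] := distinct3_perm dijk.
  exists t; apply: star0_sup => //; first by rewrite !alcove_permE t1 t2.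
  by left; apply/star_part_perm; rewrite t0 t1 t2.
have [t [t0 t1 t2]] := distinct3_perm (distinct3_flip dijk).
exists t; apply: star0_sup => //; first by left; rewrite alcove_permE t1.
by right; apply/star_part_perm; rewrite t0 t1 t2.
Qed.

Lemma star_dominant X i j k : distinct3 i j k -> dominant_at i X ->
  star P (weyl_elt X) = star_triangle X j i k `|` star_triangle X k i j.
Proof.
move=> d dX; have X0 : X <> alcove0.
  by move=> X0; have [] := (forall_neq_distinct3 _ d).1 dX; rewrite X0.
apply/seteqP; split=> v; rewrite /= star_weyl_elt //.
  move=> [p [q [r [dpqr [[dp Xv]|[/(dominant_not_opposite dX)]]]]]] //.
  rewrite (dominant_at_uniq dp dX) in dpqr Xv.
  by have [[<- <-]|[<- <-]] := distinct3_completion d dpqr; [left | right].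
case=> Xv; [exists i, j, k | exists i, k, j]; split=> //; try by left.
exact: distinct3_flip.
Qed.

Lemma star_opposite X i j k :
  distinct3 i j k -> opposite_at i X -> X <> alcove0 ->
  star P (weyl_elt X) = star_triangle X i j k `|` star_triangle X i k j.
Proof.
move=> d oX X0; apply/seteqP; split=> v; rewrite /= star_weyl_elt //.
  move=> [p [q [r [dpqr [[/dominant_not_opposite/(_ oX)]|[op Xv]]]]]] //.
  rewrite (opposite_at_uniq X0 op oX) in dpqr Xv.
  by have [[<- <-]|[<- <-]] := distinct3_completion d dpqr; [left | right].
case=> Xv; [exists i, j, k | exists i, k, j]; split=> //; try by right.
exact: distinct3_flip.
Qed.

Lemma interior_star_dominant X i j k : distinct3 i j k -> dominant_at i X ->
  interior (star P (weyl_elt X)) =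
  open_star_triangle X j i k `|` open_star_triangle X k i j.
Proof.
move=> d dX; have [Xj Xk] := (forall_neq_distinct3 _ d).1 dX.
rewrite (star_dominant d dX) /star_triangle /open_star_triangle /=.
rewrite (triangle_rot k) (open_triangle_rot k).
apply: interior_triangleU; first exact: distinct3_flip (distinct3_rot d).
all: by rewrite -intrD ltr0z; case: odd_alcove (sum_coord X d); lia.
Qed.

Lemma interior_star_opposite X i j k :
  distinct3 i j k -> opposite_at i X -> X <> alcove0 ->
  interior (star P (weyl_elt X)) =
  open_star_triangle X i j k `|` open_star_triangle X i k j.
Proof.
move=> d oX X0; have [Xj Xk] := (forall_neq_distinct3 _ d).1 oX.
have Xi := opposite_at_gt0 oX X0.
rewrite (star_opposite d oX X0) /star_triangle /open_star_triangle /=.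
rewrite -(triangle_rot j i k) -(open_triangle_rot j i k).
by apply: interior_triangleU; rewrite // -intrD ltr0z; lia.
Qed.

Theorem interior_star_weyl_elt X Z : X <> alcove0 ->
  interior (star P (weyl_elt X)) (cen P (weyl_elt Z)) <-> ~ hexle X Z.
Proof.
move=> X0; have [i] := dominant_or_opposite X0; have d := distinct3_shift i.
case=> Xi.
- rewrite (interior_star_dominant d Xi) (not_hexle_dominant Z d Xi).
  by rewrite /setU /= !open_star_triangle_cen.
- rewrite (interior_star_opposite d Xi X0) (not_hexle_opposite Z d Xi X0).
  by rewrite /setU /= !open_star_triangle_cen.
Qed.

End AffineRoots.

Theorem theoremA (R : realType) (P : rootsA2 R) (x y : 'rV[R]_2 -> 'rV[R]_2)
    (hx : W P x) (hy : W P y) (x_neq_id : x <> id) :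
  bruhat_interval P x y =
    [set z | [/\ W P z, polygon P y (cen P z) & ~ interior (star P x) (cen P z)]].
Proof.
have [[X eX] [Y ->]] := ((WP P x).1 hx, (WP P y).1 hy).
have X0 : X <> alcove0 by move=> X0; apply: x_neq_id; rewrite eX X0 weyl_elt0.
apply/seteqP; split=> z [/(WP P z)[Z ->]]; rewrite eX.
  move=> /bruhat_weyl_elt XZ /bruhat_weyl_elt ZY; split.
  - exact: W_weyl_elt.
  - by rewrite polygon_weyl_elt cen_hexagon.
  - by rewrite interior_star_weyl_elt //; apply.
rewrite polygon_weyl_elt cen_hexagon interior_star_weyl_elt // => ZY.
move=> /contrapT XZ; split; [exact: W_weyl_elt | exact/bruhat_weyl_elt..].
Qed.
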